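(* For $\alpha_1,\alpha_2>0$ with $\alpha_1+2\alpha_2=1$ let $\eta_{\alpha_1,\alpha_2}$ be the probability measure $$\eta_{\alpha_1,\alpha_2}(dx)=\frac{\sqrt{\left((\sqrt{2}+1)^2-x\right)\left(x-(\sqrt{2}-1)^2\right)}}{2\pi x}\left(\alpha_1+\frac{\alpha_2}{x^2}\right)1_{\left((\sqrt{2}-1)^2,\,(\sqrt{2}+1)^2\right)}(x)\,dx .$$ There exists $(\alpha_1,\alpha_2)\in\{(x,y)\in(0,\infty)^2:\ x+2y=1\}$ such that $\eta_{\alpha_1,\alpha_2}$ is not freely infinitely divisible.
   Context: Free infinite divisibility: for a probability measure $\mu$ on $\mathbb{R}$ let $G_\mu(z)=\int_{\mathbb{R}}\frac{1}{z-x}\,d\mu(x)$ be its Cauchy transform on the upper half-plane. It has a right inverse $G_\mu^{-1}$ on a domain $\Lambda_{\gamma,\delta}=\{z:\ \gamma|\mathrm{Re}(z)|<-\mathrm{Im}(z),\ -\delta<\mathrm{Im}(z)<0\}$ (for any $\gamma>0$ and suitable $\delta>0$), and the Voiculescu transform is $\phi_\mu(z)=G_\mu^{-1}(1/z)-z$ for $1/z\in\Lambda_{\gamma,\delta}$. The free convolution $\mu\boxplus\nu$ is the unique probability measure with $\phi_{\mu\boxplus\nu}=\phi_\mu+\phi_\nu$ on the common domain. $\mu$ is freely infinitely divisible if for each $n\in\mathbb{N}$ there is a probability measure $\rho_n$ on $\mathbb{R}$ with $\mu=\rho_n^{\boxplus n}$. *)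

(* Defs.v *)
From HB Require Import structures.
From mathcomp Require Import all_boot all_order all_algebra.
From mathcomp Require Import all_classical all_reals all_analysis.
From mathcomp Require Import complex.

Set Implicit Arguments.
Unset Strict Implicit.
Unset Printing Implicit Defensive.

Import Order.TTheory GRing.Theory Num.Theory.
Import numFieldNormedType.Exports.

Local Open Scope classical_set_scope.
Local Open Scope ring_scope.
Local Open Scope complex_scope.

Notation realProbability R := (probability (measurableTypeR R) R).

(* The complex-valued integral is taken componentwise. *)
Definition cauchy_transform (R : realType) (mu : realProbability R)
    (z : R[i]) : R[i] :=
  (\int[mu]_x complex.Re (z - x%:C)^-1) +i* (\int[mu]_x complex.Im (z - x%:C)^-1).

Definition truncated_cone (R : realType) (lam M : R) : set R[i] :=
  [set z | lam * `|complex.Re z| < complex.Im z /\ M < complex.Im z].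

Definition Lambda (R : realType) (gamma delta : R) : set R[i] :=
  [set w | [/\ gamma * `|complex.Re w| < - complex.Im w,
               - delta < complex.Im w & complex.Im w < 0]].

(* The Cauchy transform may fail to be injective on the whole upper
   half-plane; following Bercovici and Voiculescu, its right inverse on Lambda
   is the inverse of its restriction to a truncated cone on which it is
   univalent. Any two such cones give the same values on Lambda. *)
Definition cauchy_right_inverse (R : realType) (mu : realProbability R)
    (gamma delta : R) (H : R[i] -> R[i]) : Prop :=
  exists lam M : R, [/\ 0 < lam, 0 < M,
    (forall z z', truncated_cone lam M z -> truncated_cone lam M z' ->
       cauchy_transform mu z = cauchy_transform mu z' -> z = z') &
    (forall w, Lambda gamma delta w ->
       truncated_cone lam M (H w) /\ cauchy_transform mu (H w) = w)].

(* phi is the Voiculescu transform on the set of z with 1/z in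
   Lambda gamma delta; its values elsewhere are unconstrained. *)
Definition voiculescu_transform (R : realType) (mu : realProbability R)
    (gamma delta : R) (phi : R[i] -> R[i]) : Prop :=
  exists2 H, cauchy_right_inverse mu gamma delta H &
    forall z, Lambda gamma delta z^-1 -> phi z = H z^-1 - z.

(* rho is the free convolution of mu and nu. The first clause asserts that a
   common domain exists, so that the second one is never vacuous. *)
Definition free_convolution (R : realType)
    (mu nu rho : realProbability R) : Prop :=
  (forall gamma : R, 0 < gamma -> exists2 delta : R, 0 < delta &
     [/\ exists phi, voiculescu_transform mu gamma delta phi,
         exists phi, voiculescu_transform nu gamma delta phi &
         exists phi, voiculescu_transform rho gamma delta phi]) /\
  (forall (gamma delta : R) (phi_mu phi_nu phi_rho : R[i] -> R[i]),
     0 < gamma -> 0 < delta ->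
     voiculescu_transform mu gamma delta phi_mu ->
     voiculescu_transform nu gamma delta phi_nu ->
     voiculescu_transform rho gamma delta phi_rho ->
     forall z, Lambda gamma delta z^-1 -> phi_rho z = phi_mu z + phi_nu z).

(* free_power rho n mu: mu is the n-fold free convolution power of rho. *)
Inductive free_power (R : realType) (rho : realProbability R) :
    nat -> realProbability R -> Prop :=
  | free_power1 (mu : realProbability R) :
      (forall A, measurable A -> mu A = rho A) -> free_power rho 1 mu
  | free_powerS (n : nat) (nu mu : realProbability R) :
      free_power rho n nu -> free_convolution nu rho mu ->
      free_power rho n.+1 mu.

Definition freely_infinitely_divisible (R : realType)
    (mu : realProbability R) : Prop :=
  forall n : nat, (0 < n)%N ->
    exists rho : realProbability R, free_power rho n mu.

Definition eta_density (R : realType) (a1 a2 : R) (x : R) : R :=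
  let lo := (Num.sqrt 2 - 1) ^+ 2 in
  let hi := (Num.sqrt 2 + 1) ^+ 2 in
  Num.sqrt ((hi - x) * (x - lo)) / (2 * pi * x) * (a1 + a2 / x ^+ 2)
    * \1_(`]lo, hi[%classic) x.

Definition eta_measure (R : realType) (a1 a2 : R) (A : set R) : \bar R :=
  (\int[lebesgue_measure]_(x in A) (eta_density a1 a2 x)%:E)%E.

(* Main.v *)
Require Import Defs.
From HB Require Import structures.
From mathcomp Require Import all_boot all_order all_algebra.
From mathcomp Require Import all_classical all_reals all_analysis.
From mathcomp Require Import complex.
From mathcomp Require Import measurable_realfun.
From mathcomp Require Import ring lra.

(** For a compactly supported law, free infinite divisibility forces the free
    cumulants to satisfy k3^2 <= k2 k4.  For a1 = 4/5, a2 = 1/10 the measure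
    has moments 17/10, 49/10, 89/5, 363/5, hence k2 = 2.01, k3 = 2.636 and
    k4 = 3.3895, and k2 k4 < 6.82 < 6.94 < k3^2.  So it is not freely
    infinitely divisible: already a 200-th free convolution root is impossible.

    The inequality is obtained without any theory of free cumulants.  Suppose
    mu is the n-fold free power of rho.  At w = - i t, with t > 0 small, let
    H and K be the values of the inverse Cauchy transforms of mu and rho; by
    definition of the free convolution H - 1/w = n (K - 1/w)
    ([free_power_right_inverse]).  The equation G(p + i q) = - i t is
    equivalent to two real identities for the kernel 1 / ((x - p)^2 + q^2)
    ([cauchy_resolvent_point]), which give the integral of every quadratic
    polynomial against that kernel ([resolvent_quad]).

    - Since mu is compactly supported, expanding the kernel yields, after
      centring,
        p = - k3 t^2 + o(t^2)   and   q = 1/t - k2 t + k4 t^3 + o(t^3)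
      ([bounded_resolvent_asymptotics]).  Dividing by n, K has the same
      expansion with k2/n, k3/n, k4/n ([resolvent_asymptotics_div]).
    - Nothing is known about the moments of rho, but the expansion of K
      suffices.  Let X be the centred variable of rho.  By Fatou's lemma its
      second moment is at most C2 = k2/n, and its mean is zero.  For every real
      xi, the integral of X^2 (X + xi)^2 / ((X - p)^2 + q^2) is nonnegative.
      Dividing the quartic by the quadratic denominator computes this integral
      from E X, E X^2 and the two real identities; divided by t^2, it is at
      most a quantity that tends to C4 + 2 C2^2 + 2 xi C3 + xi^2 C2 when t
      tends to 0.  The discriminant of this quadratic in xi gives
      C3^2 <= C2 (C4 + 2 C2^2) ([resolvent_hankel_ge0]).

    With C_i = k_i / n this reads k3^2 <= k2 (k4 + 2 k2^2 / n)
    ([free_power_cumulant_bound]), which fails for n = 200.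

    The moments come from the integrals of sqrt(6 x - x^2 - 1) x^(j - 3) over
    the support: integrating the derivative of x^(j - 2) (6 x - x^2 - 1)^(3/2)
    gives a three-term recurrence ([sqrt_moment_rec]), and two of the integrals
    have explicit primitives ([sqrt_moment2], [sqrt_moment3]). *)

Set Implicit Arguments.
Unset Strict Implicit.
Unset Printing Implicit Defensive.

Import Order.TTheory GRing.Theory Num.Theory.
Import numFieldNormedType.Exports.
Local Open Scope classical_set_scope.
Local Open Scope ring_scope.

(** * Real-valued integrals, densities and limits *)

Section RealIntegrable.
Context d (T : measurableType d) (R : realType).
Variables (mu : {measure set T -> \bar R}) (D : set T).
Hypothesis mD : measurable D.
Implicit Types (f g : T -> R) (k : R).

Lemma rintegrableZl k f : mu.-integrable D (EFin \o f) ->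
  mu.-integrable D (EFin \o (fun x => k * f x)).
Proof.
move=> /(integrableZl mD k); exact: eq_integrable.
Qed.

Lemma rintegrableD f g : mu.-integrable D (EFin \o f) ->
  mu.-integrable D (EFin \o g) -> mu.-integrable D (EFin \o (fun x => f x + g x)).
Proof.
move=> fi gi; have := integrableD mD fi gi; exact: eq_integrable.
Qed.

Lemma rintegrableB f g : mu.-integrable D (EFin \o f) ->
  mu.-integrable D (EFin \o g) -> mu.-integrable D (EFin \o (fun x => f x - g x)).
Proof.
move=> fi gi; have := integrableB mD fi gi; exact: eq_integrable.
Qed.

Lemma RintegralD3 (a b c : R) f g h :
  mu.-integrable D (EFin \o f) -> mu.-integrable D (EFin \o g) ->
  mu.-integrable D (EFin \o h) ->
  \int[mu]_(x in D) (a * f x + b * g x + c * h x) =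
  a * \int[mu]_(x in D) f x + b * \int[mu]_(x in D) g x + c * \int[mu]_(x in D) h x.
Proof.
move=> fi gi hi; rewrite RintegralD//; first last.
- exact: rintegrableZl.
- by apply: rintegrableD; exact: rintegrableZl.
by rewrite RintegralD// ?RintegralZl//; exact: rintegrableZl.
Qed.

End RealIntegrable.

Section IntegralDensity.
Local Open Scope ereal_scope.
Local Open Scope charge_scope.
Context d (T : measurableType d) (R : realType).
Variables (nu : {finite_measure set T -> \bar R})
          (mu : {sigma_finite_measure set T -> \bar R}).

(** Both the Radon-Nikodym derivative and [h] are densities of [nu], so they
    agree almost everywhere; the change of variables for the former transfers
    to [h]. *)
Lemma integral_density (h f : T -> \bar R) (E : set T) :
  mu.-integrable setT h ->
  (forall A, measurable A -> nu A = \int[mu]_(x in A) h x) ->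
  measurable E -> nu.-integrable E f ->
  \int[nu]_(x in E) f x = \int[mu]_(x in E) (f x * h x).
Proof.
move=> hi nuE mE fi.
have mh := measurable_int mu hi.
have numu : nu `<< mu.
  apply/null_content_dominatesP => A mA A0; rewrite nuE//.
  apply: null_set_integral => //. exact: (measurable_funS measurableT (@subsetT _ _) mh).
rewrite -(Radon_Nikodym_change_of_variables numu)//.
have mf := measurable_int nu fi.
have RNi := Radon_Nikodym_integrable (nu := charge_of_finite_measure nu) numu.
have mRN := measurable_int mu RNi.
apply: ae_eq_integral => //.
- by apply: emeasurable_funM => //; exact: (measurable_funS measurableT (@subsetT _ _)).
- by apply: emeasurable_funM => //; exact: (measurable_funS measurableT (@subsetT _ _)).
- apply: ae_eqe_mul2l; apply: integral_ae_eq => //.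
  + exact: integrableS RNi.
  + exact: (measurable_funS measurableT (@subsetT _ _)).
  + by move=> A AE mA; rewrite -Radon_Nikodym_integral//; exact: nuE.
Qed.

End IntegralDensity.

Lemma cvg_bounded_mul {R : realType} (u w : nat -> R) (M : R) :
  (forall k, `|u k| <= M) -> w @ \oo --> 0 -> (fun k => u k * w k) @ \oo --> 0.
Proof.
move=> uM w0; apply: norm_cvg0.
have M0 : (fun k => M * `|w k|) @ \oo --> 0.
  rewrite -[X in _ --> X](mulr0 M); apply: cvgM; first exact: cvg_cst.
  by rewrite -(@normr0 _ R); exact: cvg_norm.
apply: (squeeze_cvgr _ (cvg_cst 0) M0); apply: nearW => k.
by rewrite normr_ge0 normrM ler_wpM2r.
Qed.

Lemma cvg_limE {R : realType} (l l' : R) (u : nat -> R) :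
  l = l' -> u @ \oo --> l -> u @ \oo --> l'.
Proof. by move=> ->. Qed.

(** * Integrals of Laurent polynomials against sqrt(6 x - x^2 - 1) *)

Section SchroederIntegrals.
Context {R : realType}.
Implicit Types (x : R) (f F : R -> R).

Local Notation leb := (@lebesgue_measure R).
Local Notation lo := ((Num.sqrt 2 - 1) ^+ 2 : R).
Local Notation hi := ((Num.sqrt 2 + 1) ^+ 2 : R).

(** The polynomial (hi - x) (x - lo): lo and hi have sum 6 and product 1. *)
Definition quad x : R := 6 * x - x ^+ 2 - 1.

Let sqrt2_sqr : Num.sqrt 2 ^+ 2 = 2 :> R.
Proof. by rewrite sqr_sqrtr. Qed.

Let sqrt2_gt1 : 1 < Num.sqrt 2 :> R.
Proof. by rewrite -[ltLHS]sqrtr1 ltr_sqrt ?ltr1n//; lra. Qed.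

Let sqrt2_lt32 : Num.sqrt 2 < 3 / 2 :> R.
Proof. have := sqrt2_sqr; have := sqrt2_gt1; nra. Qed.

Lemma lo_gt0 : 0 < lo.
Proof. by rewrite exprn_gt0// subr_gt0. Qed.

Lemma lo_lt_hi : lo < hi.
Proof. have := sqrt2_gt1; nra. Qed.

Lemma hi_lt6 : hi < 6.
Proof. have := sqrt2_sqr; have := sqrt2_lt32; nra. Qed.

Lemma quadE x : (hi - x) * (x - lo) = quad x.
Proof.
transitivity ((2 * Num.sqrt 2 ^+ 2 + 2) * x - x ^+ 2 - (Num.sqrt 2 ^+ 2 - 1) ^+ 2).
  by ring.
by rewrite sqrt2_sqr /quad; ring.
Qed.

Lemma quad_gt0 x : x \in `]lo, hi[ -> 0 < quad x.
Proof. by rewrite in_itv/= => /andP[? ?]; rewrite -quadE mulr_gt0 ?subr_gt0. Qed.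

Lemma continuous_sqrt_quad : continuous (fun x => Num.sqrt (quad x)).
Proof.
move=> x; apply: continuous_comp; last exact: sqrt_continuous.
by apply: cvgB; [apply: cvgB|];
   [apply: cvgM; [exact: cvg_cst|]|exact: exprn_continuous|exact: cvg_cst].
Qed.

Lemma is_derive_quad x : is_derive x (1 : R) quad (6 - 2 * x).
Proof. by apply: is_derive_eq; rewrite /GRing.scale/=; ring. Qed.

Lemma is_derive_sqrt_quad x : 0 < quad x ->
  is_derive x (1 : R) (fun t => Num.sqrt (quad t)) ((3 - x) / Num.sqrt (quad x)).
Proof.
move=> q0; have Q := is_derive_quad x.
have S := is_derive1_sqrt q0.
apply: (is_derive_eq (is_derive1_comp S Q)).
have : Num.sqrt (quad x) != 0 by rewrite gt_eqF// sqrtr_gt0.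
by move=> ?; field.
Qed.

(** The primitives used below contain sqrt(quad), which is not differentiable at
    the endpoints; continuity there is enough. *)
Lemma Rintegral_lo_hi f F :
  (forall x, 0 < x -> {for x, continuous f}) ->
  (forall x, 0 < x -> {for x, continuous F}) ->
  (forall x, 0 < x -> 0 < quad x -> is_derive x (1 : R) F (f x)) ->
  \int[leb]_(x in `[lo, hi]) f x = F hi - F lo.
Proof.
move=> cf cF dF; rewrite /Rintegral (@continuous_FTC2 _ _ F)//.
- exact: lo_lt_hi.
- apply: continuous_in_subspaceT => x; rewrite inE/= in_itv/= => /andP[lx _].
  exact/cf/(lt_le_trans lo_gt0).
- split.
  + move=> x xI; have xI' := xI; rewrite in_itv/= in xI'; case/andP: xI' => lx _.
    by apply: ex_derive; apply: dF; [exact: lt_trans lo_gt0 lx|exact: quad_gt0].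
  + by apply: cvg_at_right_filter; exact/cF/lo_gt0.
  + by apply: cvg_at_left_filter; apply/cF/(lt_trans lo_gt0)/lo_lt_hi.
- move=> x xI; have xI' := xI; rewrite in_itv/= in xI'; case/andP: xI' => lx _.
  rewrite derive1E; apply: derive_val.
  by apply: dF; [exact: lt_trans lo_gt0 lx|exact: quad_gt0].
Qed.

(** The integral of sqrt(quad x) x^(j - 3).  Multiplied by 1/(2 pi) it is the
    moment of order j - 2 of the Marchenko-Pastur law of rate 2; the shift keeps
    all exponents in nat. *)
Definition sqrt_moment (j : nat) : R :=
  \int[leb]_(x in `[lo, hi]) (Num.sqrt (quad x) * x ^+ j / x ^+ 3).

Let quad_lo : quad lo = 0. Proof. by rewrite -quadE subrr mulr0. Qed.
Let quad_hi : quad hi = 0. Proof. by rewrite -quadE subrr mul0r. Qed.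

Let continuous_sqrt_moment_fun j x : 0 < x ->
  {for x, continuous (fun t => Num.sqrt (quad t) * t ^+ j / t ^+ 3)}.
Proof.
move=> x0; apply: cvgM; [apply: cvgM|apply: cvgV].
- exact: continuous_sqrt_quad.
- exact: exprn_continuous.
- by rewrite expf_neq0// gt_eqF.
- exact: exprn_continuous.
Qed.

Lemma integrable_sqrt_moment j : leb.-integrable `[lo, hi]
  (EFin \o (fun x => Num.sqrt (quad x) * x ^+ j / x ^+ 3)).
Proof.
apply: continuous_compact_integrable; first exact: segment_compact.
apply: continuous_in_subspaceT => x; rewrite inE/= in_itv/= => /andP[lx _].
exact/continuous_sqrt_moment_fun/(lt_le_trans lo_gt0).
Qed.

(** The boundary terms of x^(j - 2) quad(x)^(3/2) vanish, as quad is zero at lo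
    and hi. *)
Lemma sqrt_moment_rec j :
  (j%:R + 1) * sqrt_moment j.+2 = (6 * j%:R - 3) * sqrt_moment j.+1 - (j%:R - 2) * sqrt_moment j.
Proof.
pose f x := (6 * j%:R - 3) * (Num.sqrt (quad x) * x ^+ j.+1 / x ^+ 3)
  - (j%:R - 2) * (Num.sqrt (quad x) * x ^+ j / x ^+ 3)
  - (j%:R + 1) * (Num.sqrt (quad x) * x ^+ j.+2 / x ^+ 3).
pose F x := x ^+ j * (x ^+ 2)^-1 * (quad x * Num.sqrt (quad x)).
have := @Rintegral_lo_hi f F; rewrite /F quad_lo quad_hi !mul0r !mulr0 subrr.
move=> /(_ _ _ _) => FTC.
have : \int[leb]_(x in `[lo, hi]) f x = 0.
  apply: FTC => x x0.
  - by apply: cvgB; [apply: cvgB|]; apply: cvgM;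
      solve [exact: cvg_cst|exact: continuous_sqrt_moment_fun].
  - apply: cvgM; apply: cvgM.
    + exact: exprn_continuous.
    + by apply: cvgV; [rewrite expf_neq0// gt_eqF|exact: exprn_continuous].
    + by apply: cvgB; [apply: cvgB|];
        [apply: cvgM; [exact: cvg_cst|]|exact: exprn_continuous|exact: cvg_cst].
    + exact: continuous_sqrt_quad.
  - move=> q0; have S := is_derive_sqrt_quad q0.
    have x2 : x ^+ 2 != 0 by rewrite expf_neq0// gt_eqF.
    have D n : is_derive x (1 : R) (fun t : R => t ^+ n) (n%:R * x ^+ n.-1).
      rewrite (_ : (fun t : R => t ^+ n) = id ^+ n); last by apply/funext => t; rewrite exprfctE.
      by apply: (is_derive_eq (is_deriveX n (is_derive_id x 1))); rewrite /GRing.scale/= mulr1.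
    have D2 := @is_deriveV _ (fun t => t ^+ 2) _ _ _ x2 (D 2%N).
    apply: (is_derive_eq (is_deriveM (is_deriveM (D j) D2) (is_deriveM (is_derive_quad x) S))).
    rewrite /GRing.scale/=.
    have x0' : x != 0 by rewrite gt_eqF.
    have s0 : Num.sqrt (quad x) != 0 by rewrite gt_eqF// sqrtr_gt0.
    have E : Num.sqrt (quad x) ^+ 2 = quad x by rewrite sqr_sqrtr// ltW.
    (* true also for j = 0, where j.-1 is 0 *)
    have jX : j%:R * x ^+ j.-1 = j%:R * x ^+ j / x.
      by case: (j) => [|i]; rewrite ?mul0r//= exprSr mulrA mulfK.
    rewrite {}/f !mulrfctE /= jX !(exprSr _ j.+1) !(exprSr _ j); move: s0 E.
    set s := Num.sqrt _ => s0 E.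
    by rewrite -{1}E /quad; field; rewrite x0' s0.
rewrite /f RintegralB//; first last.
- by apply: rintegrableZl => //; exact: integrable_sqrt_moment.
- by apply: rintegrableB => //; apply: rintegrableZl => //; exact: integrable_sqrt_moment.
rewrite RintegralB//; first last.
- by apply: rintegrableZl => //; exact: integrable_sqrt_moment.
- by apply: rintegrableZl => //; exact: integrable_sqrt_moment.
rewrite !RintegralZl//; try exact: integrable_sqrt_moment.
by move=> /eqP; rewrite subr_eq0 => /eqP <-.
Qed.

Let r2 : R := 2 * Num.sqrt 2.

Let r2_gt0 : 0 < r2. Proof. by have := sqrt2_gt1; rewrite /r2; lra. Qed.

Let r2_sqr : r2 ^+ 2 = 8.
Proof. by rewrite /r2 exprMn sqrt2_sqr; ring. Qed.

Let is_derive_atan_quotient (N D : R -> R) x n d :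
  is_derive x (1 : R) N n -> is_derive x (1 : R) D d -> D x != 0 ->
  is_derive x (1 : R) (fun t => atan (N t / D t))
    ((n * D x - N x * d) / (D x ^+ 2 + N x ^+ 2)).
Proof.
move=> dN dD D0.
have := @is_derive1_comp _ atan (fun t => N t / D t) _ _ _
  (is_derive1_atan _) (is_deriveM dN (is_deriveV D0 dD)).
move/is_derive_eq; apply; rewrite /GRing.scale/=.
have : D x ^+ 2 + N x ^+ 2 != 0.
  by rewrite gt_eqF// ltr_wpDr ?sqr_ge0// exprn_even_gt0.
by move=> DN0; field; rewrite DN0 D0.
Qed.

(** This function is half of asin((t - 3) / r2), because
    asin u = 2 atan(u / (1 + sqrt(1 - u^2))) and
    r2^2 - (t - 3)^2 = quad t.  Unlike asin, this form is visibly continuous up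
    to the endpoints, where the square root vanishes. *)
Let is_derive_asin1 x : 0 < quad x ->
  is_derive x (1 : R) (fun t => atan ((t - 3) / (r2 + Num.sqrt (quad t))))
    ((2 * Num.sqrt (quad x))^-1).
Proof.
move=> q0; have s0 : 0 < Num.sqrt (quad x) by rewrite sqrtr_gt0.
have D0 : r2 + Num.sqrt (quad x) != 0 by rewrite gt_eqF// addr_gt0.
have dN : is_derive x (1 : R) (fun t => t - 3) 1.
  by apply: is_derive_eq; rewrite /GRing.scale/=; ring.
have dD : is_derive x (1 : R) (fun t => r2 + Num.sqrt (quad t))
    ((3 - x) / Num.sqrt (quad x)).
  have S := is_derive_sqrt_quad q0.
  by apply: (is_derive_eq (is_deriveD (is_derive_cst r2 x 1) S)); rewrite add0r.
apply: (is_derive_eq (is_derive_atan_quotient dN dD D0)).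
have E : Num.sqrt (quad x) ^+ 2 = quad x by rewrite sqr_sqrtr// ltW.
move: s0 D0 E; rewrite /quad; set s := Num.sqrt _ => s0 D0 E.
have -> : (r2 + s) ^+ 2 + (x - 3) ^+ 2 = 2 * r2 * (r2 + s).
  rewrite (_ : (x - 3) ^+ 2 = r2 ^+ 2 - s ^+ 2); first by ring.
  by rewrite r2_sqr E; ring.
have -> : 1 * (r2 + s) - (x - 3) * ((3 - x) / s) = r2 * (r2 + s) / s.
  rewrite (_ : (x - 3) * ((3 - x) / s) = - (r2 ^+ 2 - s ^+ 2) / s).
    by field; rewrite gt_eqF.
  by rewrite r2_sqr E; field; rewrite gt_eqF.
by field; rewrite D0 !gt_eqF.
Qed.

(** Half of asin((3 t - 1) / (r2 t)), in the same form:
    (r2 t)^2 - (3 t - 1)^2 = quad t. *)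
Let is_derive_asin2 x : 0 < x -> 0 < quad x ->
  is_derive x (1 : R) (fun t => atan ((3 * t - 1) / (r2 * t + Num.sqrt (quad t))))
    ((2 * x * Num.sqrt (quad x))^-1).
Proof.
move=> x0 q0; have s0 : 0 < Num.sqrt (quad x) by rewrite sqrtr_gt0.
have D0 : r2 * x + Num.sqrt (quad x) != 0 by rewrite gt_eqF// addr_gt0// mulr_gt0.
have dN : is_derive x (1 : R) (fun t => 3 * t - 1) 3.
  by apply: is_derive_eq; rewrite /GRing.scale/=; ring.
have dD : is_derive x (1 : R) (fun t => r2 * t + Num.sqrt (quad t))
    (r2 + (3 - x) / Num.sqrt (quad x)).
  have S := is_derive_sqrt_quad q0.
  apply: (is_derive_eq (is_deriveD (is_deriveM (is_derive_cst r2 x 1) (is_derive_id x 1)) S)).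
  by rewrite /GRing.scale/=; ring.
apply: (is_derive_eq (is_derive_atan_quotient dN dD D0)).
have E : Num.sqrt (quad x) ^+ 2 = quad x by rewrite sqr_sqrtr// ltW.
move: s0 D0 E; rewrite /quad; set s := Num.sqrt _ => s0 D0 E.
have -> : (r2 * x + s) ^+ 2 + (3 * x - 1) ^+ 2 = 2 * r2 * x * (r2 * x + s).
  transitivity (r2 ^+ 2 * x ^+ 2 + 2 * r2 * x * s + (s ^+ 2 + (3 * x - 1) ^+ 2)).
    by ring.
  transitivity (r2 ^+ 2 * x ^+ 2 + 2 * r2 * x * s + r2 ^+ 2 * x ^+ 2); last by ring.
  by rewrite r2_sqr E; ring.
have -> : 3 * (r2 * x + s) - (3 * x - 1) * (r2 + (3 - x) / s)
    = r2 * (r2 * x + s) / s.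
  transitivity (r2 + (3 * s ^+ 2 - (3 * x - 1) * (3 - x)) / s).
    by field; rewrite gt_eqF.
  transitivity (r2 + r2 ^+ 2 * x / s); last by field; rewrite gt_eqF.
  by rewrite r2_sqr E; field; rewrite gt_eqF.
by field; rewrite D0 !gt_eqF.
Qed.

Let loE : lo = 3 - r2.
Proof. by rewrite sqrrB sqrt2_sqr expr1n /r2; ring. Qed.

Let hiE : hi = 3 + r2.
Proof. by rewrite sqrrD sqrt2_sqr expr1n /r2; ring. Qed.

Let continuous_asin x (N D : R -> R) : 0 < D x ->
  {for x, continuous N} -> {for x, continuous D} ->
  {for x, continuous (fun t => atan (N t / D t))}.
Proof.
move=> D0 cN cD; apply: continuous_comp; last exact: continuous_atan.
by apply: cvgM => //; apply: cvgV => //; rewrite gt_eqF.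
Qed.

Let continuous_asin1 (x : R) : {for x, continuous (fun t : R => atan ((t - 3) / (r2 + Num.sqrt (quad t))))}.
Proof.
apply: continuous_asin.
- by rewrite ltr_wpDr ?sqrtr_ge0.
- by apply: cvgB; [exact: cvg_id|exact: cvg_cst].
- by apply: cvgD; [exact: cvg_cst|exact: continuous_sqrt_quad].
Qed.

Let continuous_asin2 x : 0 < x ->
  {for x, continuous (fun t : R => atan ((3 * t - 1) / (r2 * t + Num.sqrt (quad t))))}.
Proof.
move=> x0; apply: continuous_asin.
- by rewrite ltr_wpDr ?sqrtr_ge0// mulr_gt0.
- by apply: cvgB; [apply: cvgM; [exact: cvg_cst|exact: cvg_id]|exact: cvg_cst].
- apply: cvgD; last exact: continuous_sqrt_quad.
  by apply: cvgM; [exact: cvg_cst|exact: cvg_id].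
Qed.

(** The primitive is the area function of a half disc of radius r2. *)
Lemma sqrt_moment3 : sqrt_moment 3 = 4 * pi.
Proof.
pose F x := 2^-1 * ((x - 3) * Num.sqrt (quad x))
  + 8 * atan ((x - 3) / (r2 + Num.sqrt (quad x))).
transitivity (F hi - F lo).
  apply: Rintegral_lo_hi => x x0.
  - exact: continuous_sqrt_moment_fun.
  - apply: cvgD; apply: cvgM; try exact: cvg_cst; last exact: continuous_asin1.
    by apply: cvgM; [apply: cvgB; [exact: cvg_id|exact: cvg_cst]|
                     exact: continuous_sqrt_quad].
  - move=> q0; have S := is_derive_sqrt_quad q0.
    have dL : is_derive x (1 : R) (fun t => t - 3) 1.
      by apply: is_derive_eq; rewrite /GRing.scale/=; ring.
    apply: (is_derive_eq (is_deriveD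
      (is_deriveM (is_derive_cst (2^-1 : R) x 1) (is_deriveM dL S))
      (is_deriveM (is_derive_cst (8 : R) x 1) (is_derive_asin1 q0)))).
    have s0 : 0 < Num.sqrt (quad x) by rewrite sqrtr_gt0.
    have E : Num.sqrt (quad x) ^+ 2 = quad x by rewrite sqr_sqrtr// ltW.
    rewrite mulfK ?expf_neq0 ?gt_eqF// /GRing.scale/= /cst.
    move: s0 E; rewrite /quad; set s := Num.sqrt _ => s0 E.
    transitivity ((s ^+ 2 + (8 - (x - 3) ^+ 2)) / (2 * s)).
      by field; rewrite gt_eqF.
    transitivity ((s ^+ 2 + s ^+ 2) / (2 * s)); last by field; rewrite gt_eqF.
    by rewrite E; congr (_ / _); ring.
rewrite /F quad_hi quad_lo sqrtr0 !addr0 !mulr0 !add0r hiE loE.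
rewrite (_ : (3 + r2 - 3) / r2 = 1); last by field; rewrite gt_eqF.
rewrite (_ : (3 - r2 - 3) / r2 = - 1); last by field; rewrite gt_eqF.
by rewrite atanN atan1; field.
Qed.

(** The primitive is sqrt(quad) + 3 asin((x - 3) / r2)
    - asin((3 x - 1) / (r2 x)). *)
Lemma sqrt_moment2 : sqrt_moment 2 = 2 * pi.
Proof.
pose F x := Num.sqrt (quad x)
  + 6 * atan ((x - 3) / (r2 + Num.sqrt (quad x)))
  - 2 * atan ((3 * x - 1) / (r2 * x + Num.sqrt (quad x))).
transitivity (F hi - F lo).
  apply: Rintegral_lo_hi => x x0.
  - exact: continuous_sqrt_moment_fun.
  - apply: cvgB; [apply: cvgD|]; [exact: continuous_sqrt_quad| |];
      (apply: cvgM; [exact: cvg_cst|]); [exact: continuous_asin1|exact: continuous_asin2].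
  - move=> q0.
    apply: (is_derive_eq (is_deriveB (is_deriveD (is_derive_sqrt_quad q0)
      (is_deriveM (is_derive_cst (6 : R) x 1) (is_derive_asin1 q0)))
      (is_deriveM (is_derive_cst (2 : R) x 1) (is_derive_asin2 x0 q0)))).
    have s0 : 0 < Num.sqrt (quad x) by rewrite sqrtr_gt0.
    have E : Num.sqrt (quad x) ^+ 2 = quad x by rewrite sqr_sqrtr// ltW.
    rewrite /GRing.scale/= /cst.
    move: s0 E; rewrite /quad; set s := Num.sqrt _ => s0 E.
    transitivity ((6 * x - x ^+ 2 - 1) / (x * s)).
      by field; rewrite !gt_eqF.
    by rewrite -E; field; rewrite !gt_eqF.
rewrite /F quad_hi quad_lo sqrtr0 !addr0 !add0r hiE loE.
have l0 : 0 < 3 - r2 by rewrite -loE lo_gt0.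
rewrite (_ : (3 + r2 - 3) / r2 = 1); last by field; rewrite gt_eqF.
rewrite (_ : (3 - r2 - 3) / r2 = - 1); last by field; rewrite gt_eqF.
rewrite (_ : (3 * (3 + r2) - 1) / (r2 * (3 + r2)) = 1); last first.
  rewrite (_ : 3 * (3 + r2) - 1 = r2 * (3 + r2)) ?divff ?gt_eqF ?mulr_gt0 ?addr_gt0//.
  by rewrite [RHS]mulrDr -expr2 r2_sqr; ring.
rewrite (_ : (3 * (3 - r2) - 1) / (r2 * (3 - r2)) = - 1); last first.
  rewrite (_ : 3 * (3 - r2) - 1 = - (r2 * (3 - r2))).
    by rewrite mulNr divff// gt_eqF// mulr_gt0.
  by rewrite [in RHS]mulrBr -expr2 r2_sqr; ring.
by rewrite atanN atan1; field.
Qed.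

Lemma sqrt_momentE : [/\ sqrt_moment 0 = 4 * pi, sqrt_moment 1 = 2 * pi, sqrt_moment 4 = 12 * pi,
  sqrt_moment 5 = 44 * pi & sqrt_moment 6 = 180 * pi].
Proof.
have m2 := sqrt_moment2; have m3 := sqrt_moment3.
have := sqrt_moment_rec 1; have := sqrt_moment_rec 0; have := sqrt_moment_rec 2.
have := sqrt_moment_rec 3; have := sqrt_moment_rec 4.
by rewrite m2 m3; split; lra.
Qed.

End SchroederIntegrals.
(** * The measure eta and its moments *)

Section EtaLaw.
Context {R : realType}.
Variables a1 a2 : R.
Hypotheses (a1_ge0 : 0 <= a1) (a2_ge0 : 0 <= a2).
Implicit Types x : R.

Local Notation leb := (@lebesgue_measure R).
Local Notation lo := ((Num.sqrt 2 - 1) ^+ 2 : R).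
Local Notation hi := ((Num.sqrt 2 + 1) ^+ 2 : R).
Local Notation supp := (`]lo, hi[%classic : set R).
Local Notation w j := (fun x => Num.sqrt (quad x) * x ^+ j / x ^+ 3).

Lemma eta_density_supp x : supp x ->
  eta_density a1 a2 x = (2 * pi)^-1 * (a1 * w 2%N x + a2 * w 0%N x).
Proof.
move=> xS; rewrite /eta_density quadE indicE mem_set// mulr1.
have x0 : x != 0 by rewrite gt_eqF//; move: xS; rewrite /= in_itv/= => /andP[/(lt_trans lo_gt0)].
have pi0 : (pi : R) != 0 by rewrite gt_eqF// pi_gt0.
by move: pi0; move: (pi : R) => p p0; field; rewrite x0 p0.
Qed.

Lemma eta_density_ge0 x : 0 <= eta_density a1 a2 x.
Proof.
rewrite /eta_density indicE; case: (boolP (x \in _)) => [/set_mem/=|_]; last by rewrite mulr0.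
rewrite in_itv/= mulr1 => /andP[/(lt_trans lo_gt0) x0 _].
rewrite mulr_ge0 ?addr_ge0 ?divr_ge0 ?sqrtr_ge0 ?sqr_ge0 ?mulr_ge0 ?pi_ge0//; exact: ltW.
Qed.

Lemma eta_density_notin x : ~ supp x -> eta_density a1 a2 x = 0.
Proof. by move=> xS; rewrite /eta_density indicE memNset// mulr0. Qed.

Let integrable_w j : leb.-integrable supp (EFin \o w j).
Proof.
apply: (integrableS _ _ _ (integrable_sqrt_moment j)) => //.
exact: subset_itv_oo_cc.
Qed.

Lemma integrable_eta_density : leb.-integrable setT (EFin \o eta_density a1 a2).
Proof.
rewrite (_ : EFin \o _ = (EFin \o eta_density a1 a2) \_ supp); last first.
  apply/funext => x; rewrite patchE; case: ifPn => // /negP xS /=.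
  by rewrite eta_density_notin// => /mem_set.
apply/integrable_restrict => //; rewrite setTI.
have di : leb.-integrable supp
    (EFin \o (fun x => (2 * pi)^-1 * (a1 * w 2%N x + a2 * w 0%N x))).
  by apply: rintegrableZl => //; apply: rintegrableD => //; exact: rintegrableZl.
apply: eq_integrable di => // x /set_mem xS /=.
by rewrite eta_density_supp.
Qed.

Lemma Rintegral_eta_density j :
  \int[leb]_(x in supp) (x ^+ j * eta_density a1 a2 x) =
  (a1 * sqrt_moment j.+2 + a2 * sqrt_moment j) / (2 * pi).
Proof.
transitivity (\int[leb]_(x in supp) ((2 * pi)^-1 * (a1 * w j.+2 x + a2 * w j x))).
  apply: eq_Rintegral => x /set_mem xS; rewrite eta_density_supp// !exprS expr0.
  by ring.
rewrite RintegralZl//; last by apply: rintegrableD => //; exact: rintegrableZl.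
rewrite RintegralD ?RintegralZl//; try exact: rintegrableZl.
have wE i : \int[leb]_(x in supp) w i x = sqrt_moment i.
  rewrite Rintegral_itv_bndo_bndc; last exact: integrable_w.
  rewrite Rintegral_itv_obnd_cbnd//.
  apply: (integrableS _ _ _ (integrable_sqrt_moment i)) => //.
  exact: subset_itv_oc_cc.
by rewrite !wE mulrC.
Qed.

Hypothesis a12 : a1 + 2 * a2 = 1.

Definition eta_law : set (measurableTypeR R) -> \bar R := eta_measure a1 a2.

Let eta_law0 : eta_law set0 = 0%E.
Proof. exact: integral_set0. Qed.

Let eta_law_ge0 A : (0 <= eta_law A)%E.
Proof. by apply: integral_ge0 => x _; rewrite lee_fin eta_density_ge0. Qed.

Let eta_law_sigma_additive : semi_sigma_additive eta_law.
Proof.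
move=> A mA tA mUA; rewrite /eta_law /eta_measure integral_bigcup//=; last first.
  exact: (integrableS measurableT mUA (@subsetT _ _) integrable_eta_density).
apply: is_cvg_ereal_nneg_natsum_cond => n _ _.
by apply: integral_ge0 => x _; rewrite lee_fin eta_density_ge0.
Qed.

HB.instance Definition _ := isMeasure.Build _ _ _
  eta_law eta_law0 eta_law_ge0 eta_law_sigma_additive.

Let eta_law_supp : eta_law setT = eta_law supp.
Proof.
rewrite /eta_law /eta_measure [RHS]integral_mkcond; apply: eq_integral => x _.
rewrite patchE; case: ifPn => // /negP xS.
by rewrite eta_density_notin// => /mem_set.
Qed.

Let pi_neq0 : (pi : R) != 0. Proof. by rewrite gt_eqF// pi_gt0. Qed.

Let eta_law_setT : eta_law setT = 1%E.
Proof.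
rewrite eta_law_supp /eta_law /eta_measure.
have := Rintegral_eta_density 0; have [-> _ _ _ _] := @sqrt_momentE R; rewrite sqrt_moment2.
have -> : (a1 * (2 * pi) + a2 * (4 * pi)) / (2 * pi) = 1.
  by move: pi_neq0; rewrite -[RHS]a12; move: (pi : R) => p p0; field.
rewrite /Rintegral => mass1; rewrite -[RHS]/(1%:E) -[in RHS]mass1 fineK; last first.
  apply: integrable_fin_num => //.
  have di : leb.-integrable supp (EFin \o eta_density a1 a2).
    by apply: integrableS integrable_eta_density.
  by apply: eq_integrable di => // x _ /=; rewrite mul1r.
by apply: eq_integral => x _; rewrite expr0 mul1r.
Qed.

HB.instance Definition _ :=
  @Measure_isProbability.Build _ _ R eta_law eta_law_setT.

Lemma eta_measure_probability : exists mu : realProbability R,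
  forall A : set (measurableTypeR R), measurable A -> mu A = eta_measure a1 a2 A.
Proof. by exists eta_law. Qed.

Section moments.
Variable mu : realProbability R.
Hypothesis muE : forall A : set (measurableTypeR R),
  measurable A -> mu A = eta_measure a1 a2 A.

Lemma eta_supp : mu supp = 1%E.
Proof. by rewrite muE// -eta_law_setT eta_law_supp. Qed.

Lemma eta_moment j :
  \int[mu]_(x in supp) (x ^+ j) = (a1 * sqrt_moment j.+2 + a2 * sqrt_moment j) / (2 * pi).
Proof.
rewrite -Rintegral_eta_density /Rintegral; congr fine.
rewrite (integral_density integrable_eta_density muE)//.
apply: measurable_bounded_integrable => //.
- by rewrite [X in (X < _)%E]eta_supp ltry.
- exists (hi ^+ j); split; first exact: num_real.
  move=> M hM x /=; rewrite in_itv/= => /andP[lx xh].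
  have x0 := lt_trans lo_gt0 lx.
  rewrite normrX gtr0_norm// (le_trans _ (ltW hM))//.
  by apply: lerXn2r; rewrite ?nnegrE; apply: ltW => //; exact: lt_trans xh.
Qed.

End moments.

End EtaLaw.
(** * Points where the Cauchy transform takes the value - i t *)

Section Resolvent.
Context d (T : measurableType d) (R : realType) (mu : probability T R).
Variables (S : set T) (X : T -> R).
Hypotheses (mS : measurable S) (muS : mu S = 1%E) (mX : measurable_fun S X).


(** The squared distance from a to p + i q: both the real and the imaginary part
    of 1 / (p + i q - a) have this denominator. *)
Definition qform (p q a : R) : R := (a - p) ^+ 2 + q ^+ 2.

Lemma qform_gt0 p q a : 0 < q -> 0 < qform p q a.
Proof. by move=> q0; rewrite /qform ltr_wpDl ?sqr_ge0// exprn_gt0. Qed.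

Lemma integrable_bounded (f : T -> R) (M : R) : measurable_fun S f ->
  (forall x, S x -> `|f x| <= M) -> mu.-integrable S (EFin \o f).
Proof.
move=> mf fM; apply: measurable_bounded_integrable => //.
  by rewrite (le_lt_trans (probability_le1 mu mS)) ?ltry.
exists M; split; first exact: num_real.
by move=> N MN x Sx; exact: le_trans (fM _ Sx) (ltW MN).
Qed.

Lemma Rintegral_one : \int[mu]_(x in S) (1 : R) = 1.
Proof. by rewrite Rintegral_cst// mul1r [X in fine X]muS. Qed.

Lemma shifted_moments (c : R) :
  (forall j, mu.-integrable S (EFin \o (fun x => X x ^+ j))) ->
  let m j := \int[mu]_(x in S) (X x ^+ j) in
  [/\ \int[mu]_(x in S) ((X x - c) ^+ 1) = m 1%N - c,
      \int[mu]_(x in S) ((X x - c) ^+ 2) = m 2%N - 2 * c * m 1%N + c ^+ 2,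
      \int[mu]_(x in S) ((X x - c) ^+ 3) =
        m 3%N - 3 * c * m 2%N + 3 * c ^+ 2 * m 1%N - c ^+ 3 &
      \int[mu]_(x in S) ((X x - c) ^+ 4) =
        m 4%N - 4 * c * m 3%N + 6 * c ^+ 2 * m 2%N - 4 * c ^+ 3 * m 1%N + c ^+ 4].
Proof.
move=> Xi m.
have m0 : m 0%N = 1.
  by rewrite /m; under eq_Rintegral do rewrite expr0; exact: Rintegral_one.
split.
- transitivity (\int[mu]_(x in S)
    (1 * X x ^+ 1 + (- c) * X x ^+ 0 + 0 * X x ^+ 0)).
    by apply: eq_Rintegral => x _; ring.
  by rewrite RintegralD3// -!/(m _) m0; ring.
- transitivity (\int[mu]_(x in S)
    (1 * X x ^+ 2 + (- 2 * c) * X x ^+ 1 + c ^+ 2 * X x ^+ 0)).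
    by apply: eq_Rintegral => x _; ring.
  by rewrite RintegralD3// -!/(m _) m0; ring.
- transitivity (\int[mu]_(x in S) (1 * (1 * X x ^+ 3 + (- 3 * c) * X x ^+ 2
      + (3 * c ^+ 2) * X x ^+ 1) + (- c ^+ 3) * X x ^+ 0 + 0 * X x ^+ 0)).
    by apply: eq_Rintegral => x _; ring.
  rewrite RintegralD3//; last first.
    by apply: rintegrableD => //; [apply: rintegrableD => //|]; exact: rintegrableZl.
  by rewrite RintegralD3// -!/(m _) m0; ring.
- transitivity (\int[mu]_(x in S) (1 * (1 * X x ^+ 4 + (- 4 * c) * X x ^+ 3
      + (6 * c ^+ 2) * X x ^+ 2) + (- 4 * c ^+ 3) * X x ^+ 1 + c ^+ 4 * X x ^+ 0)).
    by apply: eq_Rintegral => x _; ring.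
  rewrite RintegralD3//; last first.
    by apply: rintegrableD => //; [apply: rintegrableD => //|]; exact: rintegrableZl.
  by rewrite RintegralD3// -!/(m _) m0; ring.
Qed.

Lemma measurable_div_qform p q (f : T -> R) : 0 < q -> measurable_fun S f ->
  measurable_fun S (fun x => f x / qform p q (X x)).
Proof.
move=> q0 mf; apply: measurable_funM => //.
apply: (@measurableT_comp _ _ _ _ _ _ (fun a => (qform p q a)^-1)) => //.
apply: continuous_measurable_fun => a; apply: cvgV.
  by rewrite gt_eqF// qform_gt0.
apply: cvgD; last exact: cvg_cst.
by apply: (@cvg_comp _ _ _ (fun a => a - p) (fun a => a ^+ 2));
  [apply: cvgB; [exact: cvg_id|exact: cvg_cst]|exact: exprn_continuous].
Qed.

Lemma integrable_inv_qform p q : 0 < q ->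
  mu.-integrable S (EFin \o (fun x => (qform p q (X x))^-1)).
Proof.
move=> q0; apply: (@integrable_bounded _ (q ^- 2)).
  apply: (eq_measurable_fun (fun x => 1 / qform p q (X x))).
    by move=> x _; rewrite div1r.
  exact: measurable_div_qform.
move=> x _; rewrite gtr0_norm ?invr_gt0 ?qform_gt0//.
by rewrite lef_pV2 ?posrE ?qform_gt0 ?exprn_gt0// /qform lerDr sqr_ge0.
Qed.

Lemma integrable_sub_qform p q : 0 < q ->
  mu.-integrable S (EFin \o (fun x => (X x - p) / qform p q (X x))).
Proof.
move=> q0; apply: (@integrable_bounded _ q^-1).
  by apply: measurable_div_qform => //; exact: measurable_funB.
move=> x _; rewrite normrM normfV [`|qform _ _ _|]gtr0_norm ?qform_gt0//.
rewrite ler_pdivrMr ?qform_gt0// mulrC ler_pdivlMr// /qform.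
have := sqr_ge0 (`|X x - p| - q); rewrite -[(X x - p) ^+ 2]real_normK ?num_real//.
have : 0 <= `|X x - p| by []. nra.
Qed.

Lemma integrable_lin_qform p q c e : 0 < q ->
  mu.-integrable S (EFin \o (fun x => (c * X x + e) / qform p q (X x))).
Proof.
move=> q0.
have i1 := rintegrableD mS (rintegrableZl mS c (integrable_sub_qform p q0))
  (rintegrableZl mS (c * p + e) (integrable_inv_qform p q0)).
apply: eq_integrable i1 => // x _ /=; congr EFin.
by have := qform_gt0 p (X x) q0 => /gt_eqF/negbT ?; field.
Qed.

(** The real and imaginary parts of G(p + i q) = - i t, where G is the Cauchy
    transform of the law of [X] under [mu]. *)
Definition resolvent_point (p q t : R) : Prop :=
  [/\ 0 < q, \int[mu]_(x in S) ((X x - p) / qform p q (X x)) = 0 &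
      \int[mu]_(x in S) (qform p q (X x))^-1 = t / q].

Section ResolventPoint.
Variables p q t : R.
Hypothesis pqt : resolvent_point p q t.

Lemma resolvent_lin c e :
  \int[mu]_(x in S) ((c * X x + e) / qform p q (X x)) = (c * p + e) * (t / q).
Proof.
have [q0 H0 H1] := pqt.
transitivity (\int[mu]_(x in S) (c * ((X x - p) / qform p q (X x))
    + (c * p + e) * (qform p q (X x))^-1)).
  apply: eq_Rintegral => x _.
  by have := qform_gt0 p (X x) q0 => /gt_eqF/negbT ?; field.
rewrite RintegralD//; try by apply: rintegrableZl => //; solve
  [exact: integrable_sub_qform|exact: integrable_inv_qform].
rewrite !RintegralZl//; try solve [exact: integrable_inv_qform|exact: integrable_sub_qform].
by rewrite H0 H1 mulr0 add0r.
Qed.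

(** Division with remainder by [qform] reduces every quadratic numerator to the
    two integrals that define a resolvent point. *)
Lemma resolvent_quad c e f :
  \int[mu]_(x in S) ((c * X x ^+ 2 + e * X x + f) / qform p q (X x)) =
  c + ((e + 2 * c * p) * p + (f - c * (p ^+ 2 + q ^+ 2))) * (t / q).
Proof.
have [q0 H0 H1] := pqt.
transitivity (\int[mu]_(x in S) (c + ((e + 2 * c * p) * X x
    + (f - c * (p ^+ 2 + q ^+ 2))) / qform p q (X x))).
  apply: eq_Rintegral => x _.
  have := qform_gt0 p (X x) q0 => /gt_eqF/negbT; rewrite /qform => ?; field.
  by [].
rewrite RintegralD//; first last.
- exact: integrable_lin_qform.
- by apply: finite_measure_integrable_cst.
by rewrite resolvent_lin Rintegral_cst// [X in fine X]muS mulr1.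
Qed.

End ResolventPoint.

End Resolvent.

(** The expansions p = - C3 t^2 + o(t^2) and q = 1/t - C2 t + C4 t^3 + o(t^3).
    When p + i q is the value at - i t of the inverse Cauchy transform of a
    centred compactly supported law, C2, C3, C4 are its free cumulants. *)
Definition resolvent_asymptotics {R : realType} (p q t : nat -> R) (C2 C3 C4 : R) :=
  [/\ (fun k => p k / t k ^+ 2) @ \oo --> - C3,
      (fun k => (1 - q k * t k) / t k ^+ 2) @ \oo --> C2 &
      (fun k => ((1 - q k * t k) / t k ^+ 2 - C2) / t k ^+ 2) @ \oo --> - C4].

(** * Expansion of the inverse Cauchy transform of a bounded variable *)

Section BoundedResolvent.
Context d (T : measurableType d) (R : realType) (mu : probability T R).
Variables (S : set T) (X : T -> R).
Hypotheses (mS : measurable S) (muS : mu S = 1%E) (mX : measurable_fun S X).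
Variable B : R.
Hypothesis XB : forall x, S x -> `|X x| <= B.

Let v k : R := \int[mu]_(x in S) (X x ^+ k).
Hypothesis v1 : v 1 = 0.

Section OnePoint.
Variables p q t : R.
Hypotheses (t_gt0 : 0 < t) (pqt : resolvent_point mu S X p q t).

Let q_gt0 : 0 < q. Proof. by case: pqt. Qed.

(** p is an average of X, with weight 1 / qform. *)
Lemma resolvent_re_le : `|p| <= B.
Proof.
have tq : 0 < t / q by rewrite divr_gt0.
have D0 x := qform_gt0 p (X x) q_gt0.
rewrite ler_norml; apply/andP; split.
- rewrite -subr_ge0 opprK -(pmulr_rge0 _ tq) mulrC -[p]mul1r.
  rewrite -(resolvent_lin mS mX pqt); apply: Rintegral_ge0 => x Sx.
  rewrite divr_ge0 ?(ltW (D0 _))//.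
  by have := XB Sx; rewrite ler_norml => /andP[? ?]; lra.
- rewrite -subr_ge0 -(pmulr_rge0 _ tq) mulrC [_ - _]addrC -mulN1r.
  rewrite -(resolvent_lin mS mX pqt); apply: Rintegral_ge0 => x Sx.
  rewrite divr_ge0 ?(ltW (D0 _))//.
  by have := XB Sx; rewrite ler_norml => /andP[? ?]; lra.
Qed.

Let integrable_X k : mu.-integrable S (EFin \o (fun x => X x ^+ k)).
Proof.
apply: (integrable_bounded mu mS (M := B ^+ k)); first exact: measurable_funX.
move=> x Sx; rewrite normrX; apply: lerXn2r; rewrite ?nnegrE ?normr_ge0 ?XB//.
exact: le_trans (XB Sx).
Qed.

Let Y x := X x - p.

Let Y_le x : S x -> `|Y x| <= 2 * B.
Proof.
move=> Sx; rewrite (le_trans (ler_normB _ _))// mulr2n mulrDl mul1r lerD ?XB//.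
exact: resolvent_re_le.
Qed.

Let B_ge0 : 0 <= B. Proof. exact: le_trans resolvent_re_le. Qed.

Let Yk_le k x : S x -> `|Y x ^+ k| <= (2 * B) ^+ k.
Proof.
move=> Sx; rewrite normrX; apply: lerXn2r; rewrite ?nnegrE ?normr_ge0//.
  exact: mulr_ge0.
exact: Y_le.
Qed.

Let measurable_Y k : measurable_fun S (fun x => Y x ^+ k).
Proof. by apply: measurable_funX; exact: measurable_funB. Qed.

Let integrable_Y k : mu.-integrable S (EFin \o (fun x => Y x ^+ k)).
Proof. exact: (integrable_bounded mu mS (measurable_Y k) (Yk_le k)). Qed.

Let Yk_div_le k x : S x -> `|Y x ^+ k / qform p q (X x)| <= (2 * B) ^+ k / q ^+ 2.
Proof.
move=> Sx; rewrite normrM normfV [`|qform _ _ _|]gtr0_norm ?qform_gt0//.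
apply: ler_pM => //; first by rewrite invr_ge0 ltW// qform_gt0.
  exact: Yk_le.
by rewrite lef_pV2 ?posrE ?qform_gt0 ?exprn_gt0// /qform lerDr sqr_ge0.
Qed.

Let integrable_Y_div k :
  mu.-integrable S (EFin \o (fun x => Y x ^+ k / qform p q (X x))).
Proof.
apply: (integrable_bounded mu mS _ (Yk_div_le k)).
exact: measurable_div_qform.
Qed.

(** The remainder of order k of the expansion of the kernel, scaled so as to stay
    bounded when q tends to infinity. *)
Let rest k : R := q ^+ 2 * \int[mu]_(x in S) (Y x ^+ k / qform p q (X x)).

Lemma resolvent_rest_le k : `|rest k| <= (2 * B) ^+ k.
Proof.
rewrite normrM ger0_norm ?sqr_ge0// mulrC -ler_pdivlMr ?exprn_gt0//.
apply: (le_trans (le_normr_Rintegral mS (integrable_Y_div k))).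
have -> : (2 * B) ^+ k / q ^+ 2 = \int[mu]_(x in S) ((2 * B) ^+ k / q ^+ 2).
  by rewrite Rintegral_cst// [X in fine X]muS mulr1.
apply: le_Rintegral => //.
- apply: (integrable_bounded mu mS (M := (2 * B) ^+ k / q ^+ 2)).
    by apply: measurableT_comp => //; exact: measurable_div_qform.
  by move=> x Sx; rewrite normr_id; exact: Yk_div_le.
- exact: finite_measure_integrable_cst.
- by move=> x Sx; exact: Yk_div_le.
Qed.

(** 1 - q t is the integral of (X - p)^2 / qform.  As q stays away from 0, this
    forces q t to tend to 1 when t tends to 0. *)
Lemma resolvent_im_bounds : 0 <= 1 - q * t <= (2 * B) ^+ 2 * (t / q).
Proof.
have E : \int[mu]_(x in S) (Y x ^+ 2 / qform p q (X x)) = 1 - q * t.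
  transitivity (\int[mu]_(x in S)
    ((1 * X x ^+ 2 + (- 2 * p) * X x + p ^+ 2) / qform p q (X x))).
    by apply: eq_Rintegral => x _; congr (_ / _); rewrite /Y; ring.
  by rewrite (resolvent_quad mS muS mX pqt); field; rewrite gt_eqF.
have [_ _ H1] := pqt; rewrite -E; apply/andP; split.
  by apply: Rintegral_ge0 => x _; rewrite divr_ge0 ?sqr_ge0 ?ltW ?qform_gt0.
rewrite -H1 -RintegralZl//; last exact: integrable_inv_qform.
apply: le_Rintegral => //.
- by apply: rintegrableZl => //; exact: integrable_inv_qform.
move=> x Sx; apply: ler_wpM2r; first by rewrite invr_ge0 ltW// qform_gt0.
by have := Yk_le 2 Sx; rewrite ger0_norm ?sqr_ge0.
Qed.

Let c k : R := \int[mu]_(x in S) (Y x ^+ k).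

(** The kernel is a geometric series in ((X - p) / q)^2, stopped after three
    terms. *)
Lemma resolvent_im_expansion :
  q * t = 1 - c 2 / q ^+ 2 + c 4 / q ^+ 4 - rest 6 / q ^+ 6.
Proof.
have [_ _ H1] := pqt; have q0 := q_gt0.
have -> : q * t = q ^+ 2 * (t / q) by field; rewrite gt_eqF.
rewrite -H1.
have -> : \int[mu]_(x in S) (qform p q (X x))^-1 =
  \int[mu]_(x in S) ((q ^- 2 - q ^- 4 * Y x ^+ 2) +
     (q ^- 6 * Y x ^+ 4 - q ^- 6 * (Y x ^+ 6 / qform p q (X x)))).
  apply: eq_Rintegral => x _; have := qform_gt0 p (X x) q0.
  rewrite /qform -/(Y x) => /gt_eqF/negbT ?; field.
  by apply/andP; split => //; rewrite gt_eqF.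
rewrite RintegralD//; first last.
- by apply: rintegrableB => //; exact: rintegrableZl.
- apply: rintegrableB => //; last exact: rintegrableZl.
  exact: finite_measure_integrable_cst.
rewrite !RintegralB//; try exact: rintegrableZl;
  try exact: finite_measure_integrable_cst.
rewrite !RintegralZl// Rintegral_cst// [X in fine X]muS mulr1 /rest /c.
by field; rewrite gt_eqF.
Qed.

(** The same series multiplied by X - p, which integrates to 0 by definition of a
    resolvent point; the term of order 1 is - p because X is centred. *)
Lemma resolvent_re_expansion : p = - c 3 / q ^+ 2 + rest 5 / q ^+ 4.
Proof.
have [_ H0 _] := pqt; have q0 := q_gt0.
have c1 : c 1 = - p.
  by have [+ _ _ _] := shifted_moments mS muS p integrable_X; rewrite -/(v 1) v1 sub0r.
have : 0 = q ^- 2 * c 1 - q ^- 4 * c 3 + q ^- 4 * (rest 5 / q ^+ 2).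
  rewrite -[LHS]H0.
  have -> : \int[mu]_(x in S) ((X x - p) / qform p q (X x)) =
    \int[mu]_(x in S) ((q ^- 2 * Y x ^+ 1 - q ^- 4 * Y x ^+ 3) +
       q ^- 4 * (Y x ^+ 5 / qform p q (X x))).
    apply: eq_Rintegral => x _; have := qform_gt0 p (X x) q0.
    rewrite /qform -/(Y x) => /gt_eqF/negbT ?; field.
    by apply/andP; split => //; rewrite gt_eqF.
  rewrite RintegralD//; first last.
  - exact: rintegrableZl.
  - by apply: rintegrableB => //; exact: rintegrableZl.
  rewrite !RintegralB//; try exact: rintegrableZl.
  rewrite !RintegralZl// /rest /c mulrAC mulfV ?mul1r//.
  by rewrite expf_neq0// gt_eqF.
rewrite c1 => /eqP; rewrite eq_sym => /eqP E.
apply/eqP; rewrite -subr_eq0; apply/eqP.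
apply: (mulfI (_ : - q ^- 2 != 0)); first by rewrite oppr_eq0 invr_eq0 expf_neq0// gt_eqF.
by rewrite mulr0 -[RHS]E; field; rewrite gt_eqF.
Qed.

Lemma shifted_moment_le k : `|c k| <= (2 * B) ^+ k.
Proof.
apply: (le_trans (le_normr_Rintegral mS (integrable_Y k))).
have -> : (2 * B) ^+ k = \int[mu]_(x in S) ((2 * B) ^+ k).
  by rewrite Rintegral_cst// [X in fine X]muS mulr1.
apply: le_Rintegral => //.
- apply: (integrable_bounded mu mS (M := (2 * B) ^+ k)).
    exact: measurableT_comp.
  by move=> x Sx; rewrite normr_id; exact: Yk_le.
- exact: finite_measure_integrable_cst.
- by move=> x Sx; exact: Yk_le.
Qed.

Lemma recentered_moments : [/\ c 2 = v 2 + p ^+ 2,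
  c 3 = v 3 - 3 * p * v 2 - p ^+ 3 &
  c 4 = v 4 - 4 * p * v 3 + 6 * p ^+ 2 * v 2 + p ^+ 4].
Proof.
have [_] := shifted_moments mS muS p integrable_X.
rewrite -/(v 1) -/(v 2) -/(v 3) -/(v 4) v1 /c /Y => -> -> ->.
by split; ring.
Qed.

End OnePoint.

Section Asymptotics.
Variables (p q t : nat -> R) (M : R).
Hypotheses (t_gt0 : forall k, 0 < t k) (t_cvg0 : t @ \oo --> 0).
Hypothesis pqt : forall k, resolvent_point mu S X (p k) (q k) (t k).
Hypotheses (M_gt0 : 0 < M) (qM : forall k, M < q k).

Let B_ge0 : 0 <= B.
Proof. exact: le_trans (resolvent_re_le (t_gt0 0) (pqt 0)). Qed.

Let s k := q k * t k.

Let q_gt0 k : 0 < q k. Proof. exact: lt_trans (qM k). Qed.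
Let s_gt0 k : 0 < s k. Proof. exact: mulr_gt0. Qed.

Let s_cvg1 : s @ \oo --> (1 : R).
Proof.
have lim1 : (fun k => 1 - (2 * B) ^+ 2 / M * t k) @ \oo --> (1 : R).
  rewrite -[X in _ --> X]subr0; apply: cvgB; first exact: cvg_cst.
  by rewrite -[X in _ --> X](mulr0 ((2 * B) ^+ 2 / M)); apply: cvgM => //; exact: cvg_cst.
apply: (squeeze_cvgr _ lim1 (cvg_cst (1 : R))).
apply: nearW => k; have /andP[h1 h2] := resolvent_im_bounds (t_gt0 k) (pqt k).
apply/andP; split; last by rewrite -subr_ge0.
rewrite lerBlDr -lerBlDl (le_trans h2)// -mulrA [_^-1 * _]mulrC.
apply: ler_wpM2l; first exact: sqr_ge0.
apply: ler_wpM2l; first exact: ltW.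
by rewrite lef_pV2 ?posrE ?ltW.
Qed.

(* 1 / q is t i, so that every negative power of q becomes a power of t times a
   factor that tends to 1 *)
Let i k := (s k)^-1.

Let i_cvg1 : i @ \oo --> (1 : R).
Proof.
apply: (@cvg_limE _ 1^-1); first by rewrite invr1.
by apply: cvgV => //; exact: oner_neq0.
Qed.

Let c j k : R := \int[mu]_(x in S) ((X x - p k) ^+ j).
Let r j k : R := q k ^+ 2 * \int[mu]_(x in S) ((X x - p k) ^+ j / qform (p k) (q k) (X x)).

Let tX_cvg0 n : (fun k => t k ^+ n.+1) @ \oo --> 0.
Proof.
elim: n => [|n IH]; first by under eq_fun do rewrite expr1.
under eq_fun do rewrite exprS.
by apply: (@cvg_limE _ (0 * 0)); [rewrite mulr0|apply: cvgM].
Qed.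

Let iX_cvg1 n : (fun k => i k ^+ n) @ \oo --> (1 : R).
Proof.
elim: n => [|n IH].
  by under eq_fun do rewrite expr0; exact: cvg_cst.
under eq_fun do rewrite exprS.
by apply: (@cvg_limE _ (1 * 1)); [rewrite mulr1|apply: cvgM].
Qed.

Let r_mul_cvg0 j n : (fun k => r j k * t k ^+ n.+1) @ \oo --> 0.
Proof.
apply: cvg_bounded_mul (tX_cvg0 n) => k.
exact: resolvent_rest_le (t_gt0 k) (pqt k) j.
Qed.

Let c_mul_cvg0 j n : (fun k => c j k * t k ^+ n.+1) @ \oo --> 0.
Proof.
apply: cvg_bounded_mul (tX_cvg0 n) => k.
exact: shifted_moment_le (t_gt0 k) (pqt k) j.
Qed.

Let qE k : q k = (t k * i k)^-1.
Proof. by rewrite /i /s; field; rewrite !gt_eqF. Qed.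

Let pE k : p k / t k ^+ 2 = - c 3 k * i k ^+ 2 + r 5 k * t k ^+ 2 * i k ^+ 4.
Proof.
rewrite [in LHS](resolvent_re_expansion (t_gt0 k) (pqt k)) -/(c 3 k) -/(r 5 k) qE.
by field; rewrite !gt_eqF// invr_gt0.
Qed.

Let e k := (1 - s k) / t k ^+ 2.

Let eE k : e k = c 2 k * i k ^+ 2 - c 4 k * t k ^+ 2 * i k ^+ 4
  + r 6 k * t k ^+ 4 * i k ^+ 6.
Proof.
rewrite /e /s (resolvent_im_expansion (t_gt0 k) (pqt k)) -/(c 2 k) -/(c 4 k) -/(r 6 k) qE.
by field; rewrite !gt_eqF// invr_gt0.
Qed.

Let p_cvg0 : p @ \oo --> 0.
Proof.
have -> : p = (fun k => - (c 3 k * t k ^+ 2) * i k ^+ 2 + r 5 k * t k ^+ 4 * i k ^+ 4).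
  apply/funext => k; rewrite -[LHS](divfK (_ : t k ^+ 2 != 0)).
    by rewrite pE; ring.
  by rewrite expf_neq0// gt_eqF.
apply: (@cvg_limE _ (- 0 * 1 + 0 * 1)); first by ring.
by apply: cvgD; apply: cvgM => //; apply: cvgN.
Qed.

Let pX_cvg0 n : (fun k => p k ^+ n.+1) @ \oo --> 0.
Proof.
elim: n => [|n IH]; first by under eq_fun do rewrite expr1.
under eq_fun do rewrite exprS.
by apply: (@cvg_limE _ (0 * 0)); [rewrite mulr0|apply: cvgM].
Qed.

Let c_cvg : [/\ c 2 @ \oo --> v 2, c 3 @ \oo --> v 3 & c 4 @ \oo --> v 4].
Proof.
have cE k := recentered_moments (p k).
split.
- have -> : c 2 = (fun k => v 2 + p k ^+ 2).
    by apply/funext => k; have [] := cE k.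
  apply: (@cvg_limE _ (v 2 + 0)); first by rewrite addr0.
  by apply: cvgD; [exact: cvg_cst|exact: (pX_cvg0 1)].
- have -> : c 3 = (fun k => v 3 - 3 * p k * v 2 - p k ^+ 3).
    by apply/funext => k; have [] := cE k.
  apply: (@cvg_limE _ (v 3 - 3 * 0 * v 2 - 0)); first by ring.
  apply: cvgB; last exact: (pX_cvg0 2).
  apply: cvgB; [exact: cvg_cst|apply: cvgM; last exact: cvg_cst].
  by apply: cvgM => //; exact: cvg_cst.
- have -> : c 4 = (fun k => v 4 - 4 * p k * v 3 + 6 * p k ^+ 2 * v 2 + p k ^+ 4).
    by apply/funext => k; have [] := cE k.
  apply: (@cvg_limE _ (v 4 - 4 * 0 * v 3 + 6 * 0 * v 2 + 0)); first by ring.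
  apply: cvgD; last exact: (pX_cvg0 3).
  apply: cvgD; [apply: cvgB; first exact: cvg_cst|];
    (apply: cvgM; last exact: cvg_cst); (apply: cvgM; first exact: cvg_cst) => //.
Qed.

(** For a centred variable the free cumulants of order 2, 3 and 4 are v2, v3 and
    v4 - 2 v2^2.  The term - 2 v2^2 appears because the expansion
    q t = 1 - c2 / q^2 + c4 / q^4 + ... is in powers of 1/q instead of t. *)
Lemma bounded_resolvent_asymptotics :
  resolvent_asymptotics p q t (v 2) (v 3) (v 4 - 2 * v 2 ^+ 2).
Proof.
have [c2 c3 c4] := c_cvg.
have pt : (fun k => p k / t k ^+ 2) @ \oo --> - v 3.
  rewrite (funext pE).
  apply: (@cvg_limE _ (- v 3 * 1 + 0 * 1)); first by ring.
  by apply: cvgD; apply: cvgM => //; apply: cvgN.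
have et : e @ \oo --> v 2.
  rewrite (funext eE).
  apply: (@cvg_limE _ (v 2 * 1 - 0 * 1 + 0 * 1)); first by ring.
  by apply: cvgD; [apply: cvgB|]; apply: cvgM.
split=> //.
(* the first summand is v2 (1 / s^2 - 1) / t^2, rewritten with 1 - s = e t^2 *)
have -> : (fun k => ((1 - q k * t k) / t k ^+ 2 - v 2) / t k ^+ 2) =
  (fun k => v 2 * e k * (1 + s k) * i k ^+ 2 + p k / t k ^+ 2 * p k * i k ^+ 2
     - c 4 k * i k ^+ 4 + r 6 k * t k ^+ 2 * i k ^+ 6).
  apply/funext => k; have [c2E _ _] := recentered_moments (p k).
  rewrite -/(s k) -/(e k) [in LHS]eE /c c2E -/(c 4 k) /e /i.
  by field; rewrite !gt_eqF.
apply: (@cvg_limE _ (v 2 * v 2 * (1 + 1) * 1 + - v 3 * 0 * 1 - v 4 * 1 + 0 * 1)).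
  by ring.
apply: cvgD; last exact: cvgM.
apply: cvgB; last exact: cvgM.
apply: cvgD; apply: cvgM => //; apply: cvgM => //.
- by apply: cvgM => //; exact: cvg_cst.
- by apply: cvgD => //; exact: cvg_cst.
Qed.

End Asymptotics.

End BoundedResolvent.
(** * A Hankel inequality that does not assume finite moments *)

Section ResolventPositivity.
Context d (T : measurableType d) (R : realType) (mu : probability T R).
Variables (S : set T) (X : T -> R).
Hypotheses (mS : measurable S) (muS : mu S = 1%E) (mX : measurable_fun S X).
Variables (p q t : nat -> R) (C2 C3 C4 : R).
Hypotheses (t_gt0 : forall k, 0 < t k) (t_cvg0 : t @ \oo --> 0).
Hypothesis pqt : forall k, resolvent_point mu S X (p k) (q k) (t k).
Hypothesis asym : resolvent_asymptotics p q t C2 C3 C4.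

Let q_gt0 k : 0 < q k. Proof. by case: (pqt k). Qed.

Let s k := q k * t k.
Let s_gt0 k : 0 < s k. Proof. exact: mulr_gt0. Qed.
Let e k := (1 - s k) / t k ^+ 2.

Let pt_cvg : (fun k => p k / t k ^+ 2) @ \oo --> - C3.
Proof. by case: asym. Qed.

Let e_cvg : e @ \oo --> C2. Proof. by case: asym. Qed.

Let et_cvg : (fun k => (e k - C2) / t k ^+ 2) @ \oo --> - C4.
Proof. by case: asym. Qed.

Let t2_cvg0 : (fun k => t k ^+ 2) @ \oo --> 0.
Proof. by apply: (@cvg_limE _ (0 * 0)); [rewrite mulr0|apply: cvgM]. Qed.

Let t2_neq0 k : t k ^+ 2 != 0. Proof. by rewrite expf_neq0// gt_eqF. Qed.

Let s_cvg1 : s @ \oo --> (1 : R).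
Proof.
have -> : s = (fun k => 1 - e k * t k ^+ 2).
  by apply/funext => k; rewrite /e divfK//; ring.
apply: (@cvg_limE _ (1 - C2 * 0)); first by ring.
by apply: cvgB; [exact: cvg_cst|exact: cvgM].
Qed.

Let i k := (s k)^-1.
Let i_cvg1 : i @ \oo --> (1 : R).
Proof.
apply: (@cvg_limE _ 1^-1); first by rewrite invr1.
by apply: cvgV => //; exact: oner_neq0.
Qed.

Let p_cvg0 : p @ \oo --> 0.
Proof.
have -> : p = (fun k => p k / t k ^+ 2 * t k ^+ 2).
  by apply/funext => k; rewrite divfK.
by apply: (@cvg_limE _ (- C3 * 0)); [rewrite mulr0|apply: cvgM].
Qed.

Let p2_cvg0 : (fun k => p k ^+ 2) @ \oo --> 0.
Proof. by apply: (@cvg_limE _ (0 * 0)); [rewrite mulr0|apply: cvgM]. Qed.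

Let u k : R := \int[mu]_(x in S) (X x ^+ 2 / qform (p k) (q k) (X x)).

Let u_t k : u k / t k ^+ 2 = e k + p k ^+ 2 * i k.
Proof.
have -> : u k = 1 + (p k ^+ 2 - q k ^+ 2) * (t k / q k).
  transitivity (\int[mu]_(x in S)
      ((1 * X x ^+ 2 + 0 * X x + 0) / qform (p k) (q k) (X x))).
    by apply: eq_Rintegral => x _; congr (_ / _); ring.
  by rewrite (resolvent_quad mS muS mX (pqt k)); congr (_ + _); ring.
by rewrite /e /i /s; field; rewrite !gt_eqF.
Qed.

Let ut_cvg : (fun k => u k / t k ^+ 2) @ \oo --> C2.
Proof.
rewrite (funext u_t); apply: (@cvg_limE _ (C2 + 0 * 1)); first by ring.
by apply: cvgD => //; exact: cvgM.
Qed.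

Let C2_ge0 : 0 <= C2.
Proof.
apply: (cvgr_to_ge ut_cvg); apply: nearW => k.
rewrite divr_ge0 ?sqr_ge0//; apply: Rintegral_ge0 => x _.
by rewrite divr_ge0 ?sqr_ge0// ltW// qform_gt0.
Qed.

Let integrable_X2_qform k :
  mu.-integrable S (EFin \o (fun x => X x ^+ 2 / qform (p k) (q k) (X x))).
Proof.
have i1 := rintegrableD mS (@finite_measure_integrable_cst _ _ _ mu S 1 mS)
  (integrable_lin_qform mu mS mX (p k) (2 * p k) (- (p k ^+ 2 + q k ^+ 2)) (q_gt0 k)).
apply: eq_integrable i1 => // x _ /=; congr EFin.
have := qform_gt0 (p k) (X x) (q_gt0 k) => /gt_eqF/negbT; rewrite /qform /cst => ?; field.
by [].
Qed.

(** X^2 / (t^2 qform) tends to X^2 pointwise, and its integral u / t^2 tends to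
    C2, so this is Fatou's lemma. *)
Let X2_bound : (\int[mu]_(x in S) (X x ^+ 2)%:E <= C2%:E)%E.
Proof.
pose f k x := (X x ^+ 2 / qform (p k) (q k) (X x) / t k ^+ 2)%:E.
have f_int k : (\int[mu]_(x in S) f k x)%E = (u k / t k ^+ 2)%:E.
  rewrite /f /u; under eq_integral do rewrite mulrC.
  have ifk := rintegrableZl mS (t k ^- 2) (integrable_X2_qform k).
  rewrite mulrC -RintegralZl// /Rintegral fineK//.
  exact: integrable_fin_num ifk.
have f_lim x : limn_einf (f^~ x) = (X x ^+ 2)%:E.
  have fx : (f ^~ x) @ \oo --> (X x ^+ 2)%:E.
    apply/cvg_EFin; first exact: nearW.
    have -> : fine \o f^~ x =
        (fun k => X x ^+ 2 * ((X x - p k) ^+ 2 * t k ^+ 2 + s k ^+ 2)^-1).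
      apply/funext => k /=; rewrite /s exprMn -mulrDl.
      by rewrite -/(qform _ _ _) -mulrA -invfM.
    apply: (@cvg_limE _ (X x ^+ 2 * ((X x - 0) * (X x - 0) * 0 + 1 * 1)^-1)).
      by rewrite mulr0 add0r mulr1 invr1 mulr1.
    apply: cvgM; first exact: cvg_cst.
    apply: cvgV; first by rewrite mulr0 add0r mulr1 oner_neq0.
    by apply: cvgD; apply: cvgM => //; apply: cvgM; apply: cvgB => //; exact: cvg_cst.
  by rewrite is_cvg_limn_einfE; [exact/cvg_lim|apply/cvg_ex; eexists; exact: fx].
have := @fatou _ _ _ mu S mS f.
under eq_integral do rewrite f_lim.
move=> /(_ _ _)/le_trans; apply.
- move=> k; apply/measurable_EFinP; apply: measurable_funM => //.
  by apply: measurable_div_qform => //; exact: measurable_funX.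
- move=> k x _; rewrite lee_fin divr_ge0 ?sqr_ge0// divr_ge0 ?sqr_ge0//.
  by rewrite ltW// qform_gt0.
have uC : (fun k => (u k / t k ^+ 2)%:E) @ \oo --> C2%:E.
  by apply/cvg_EFin => //; exact: nearW.
rewrite (funext f_int) is_cvg_limn_einfE; first by rewrite (cvg_lim _ uC).
by apply/cvg_ex; exists C2%:E.
Qed.

Let measurable_XX n : measurable_fun S (fun x => X x ^+ n).
Proof. exact: measurable_funX. Qed.

Let integrable_X2 : mu.-integrable S (EFin \o (fun x => X x ^+ 2)).
Proof.
apply/integrableP; split; first exact/measurable_EFinP.
under eq_integral do rewrite /= ger0_norm ?sqr_ge0//.
exact: le_lt_trans X2_bound (ltry _).
Qed.

Let m2 := \int[mu]_(x in S) (X x ^+ 2).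

Let m2_le : m2 <= C2.
Proof.
rewrite -lee_fin /m2 /Rintegral fineK; first exact: X2_bound.
exact: integrable_fin_num integrable_X2.
Qed.

Let integrable_X : mu.-integrable S (EFin \o X).
Proof.
have i1 := rintegrableD mS (@finite_measure_integrable_cst _ _ _ mu S 1 mS) integrable_X2.
apply: le_integrable i1 => //; first exact/measurable_EFinP.
move=> x Sx; rewrite lee_fin /= [X in _ <= X]ger0_norm ?addr_ge0 ?sqr_ge0//.
rewrite -[X x ^+ 2]real_normK ?num_real// /cst.
have := sqr_ge0 (`|X x| - 1); have := normr_ge0 (X x); nra.
Qed.

(** With this factor, X^3 / qform is dominated by X^2; equal to
    1 / (2 q) + |p| / q^2. *)
Let kap k := t k * i k / 2 + `|p k| * t k ^+ 2 * i k ^+ 2.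

Let X3_le k x :
  `|X x ^+ 3 / qform (p k) (q k) (X x)| <= kap k * X x ^+ 2.
Proof.
have D0 := qform_gt0 (p k) (X x) (q_gt0 k).
have q0 := q_gt0 k.
rewrite normrM normfV [`|qform _ _ _|]gtr0_norm// ler_pdivrMr//.
rewrite normrX (exprSr _ 2) real_normK ?num_real//.
rewrite [kap _ * _]mulrC -[leRHS]mulrA.
apply: ler_wpM2l; first exact: sqr_ge0.
have -> : kap k = (2 * q k)^-1 + `|p k| / q k ^+ 2.
  by rewrite /kap /i /s; field; rewrite !gt_eqF.
apply: (@le_trans _ _ (`|X x - p k| + `|p k|)).
  by rewrite -[in leLHS](subrK (p k) (X x)) ler_normD.
rewrite mulrDl; apply: lerD.
- rewrite mulrC ler_pdivlMr ?mulr_gt0// /qform -[(X x - _) ^+ 2]real_normK ?num_real//.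
  have := sqr_ge0 (`|X x - p k| - q k); nra.
- rewrite -mulrA ler_peMr// mulrC ler_pdivlMr ?exprn_gt0// mul1r /qform.
  by rewrite lerDr sqr_ge0.
Qed.

Let integrable_X3 k :
  mu.-integrable S (EFin \o (fun x => X x ^+ 3 / qform (p k) (q k) (X x))).
Proof.
have i1 := rintegrableZl mS (kap k) integrable_X2.
apply: le_integrable i1 => //.
  by apply/measurable_EFinP; exact: measurable_div_qform.
move=> x Sx; rewrite lee_fin /=.
exact: le_trans (X3_le k x) (ler_norm _).
Qed.

Let kap_cvg0 : kap @ \oo --> 0.
Proof.
apply: (@cvg_limE _ (0 * 1 * 2^-1 + `|0 : R| * 0 * (1 * 1))).
  by rewrite normr0; ring.
apply: cvgD.
  by apply: cvgM; [exact: cvgM|exact: cvg_cst].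
by apply: cvgM; [apply: cvgM => //; exact: cvg_norm|exact: cvgM].
Qed.

(** X = X qform / qform expresses the mean by the integrals of X^3 / qform,
    X^2 / qform and X / qform, with coefficients 1, - 2 p and p^2 + q^2.  Each
    of the three contributions tends to 0, and the mean does not depend on k. *)
Let mean_eq0 : \int[mu]_(x in S) X x = 0.
Proof.
pose w k := \int[mu]_(x in S) (X x ^+ 3 / qform (p k) (q k) (X x)).
pose r k := p k ^+ 2 + q k ^+ 2.
have w_cvg0 : w @ \oo --> 0.
  apply: norm_cvg0; apply: (squeeze_cvgr _ (cvg_cst 0) (_ : (fun k => kap k * m2) @ \oo --> 0)).
    apply: nearW => k; rewrite normr_ge0 /=.
    apply: (le_trans (le_normr_Rintegral mS (integrable_X3 k))).
    rewrite -RintegralZl//; apply: le_Rintegral => //.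
    + have i1 := integrable_abse (integrable_X3 k).
      exact: eq_integrable i1.
    + exact: rintegrableZl.
  by apply: (@cvg_limE _ (0 * m2)); [rewrite mul0r|apply: cvgM => //; exact: cvg_cst].
have E k : \int[mu]_(x in S) X x =
    w k - 2 * p k * u k + p k * (p k ^+ 2 * (t k * t k) * i k + s k).
  have -> : \int[mu]_(x in S) X x = \int[mu]_(x in S)
     ((1 * (X x ^+ 3 / qform (p k) (q k) (X x))
       + (- 2 * p k) * (X x ^+ 2 / qform (p k) (q k) (X x)))
       + 1 * ((r k * X x + 0) / qform (p k) (q k) (X x))).
    apply: eq_Rintegral => x _.
    have := qform_gt0 (p k) (X x) (q_gt0 k) => /gt_eqF/negbT; rewrite /qform /r => ?; field.
    by [].
  rewrite RintegralD3//; last exact: integrable_lin_qform.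
  rewrite (resolvent_lin mS mX (pqt k)) -/(w k) -/(u k) /r /i /s.
  by field; rewrite !gt_eqF.
have u_cvg0 : u @ \oo --> 0.
  have -> : u = (fun k => u k / t k ^+ 2 * t k ^+ 2).
    by apply/funext => k; rewrite divfK.
  by apply: (@cvg_limE _ (C2 * 0)); [rewrite mulr0|apply: cvgM].
have m1_cvg0 : (fun k : nat => \int[mu]_(x in S) X x) @ \oo --> 0.
  rewrite (funext E).
  apply: (@cvg_limE _ (0 - 2 * 0 * 0 + 0 * (0 * (0 * 0) * 1 + 1))); first by ring.
  apply: cvgD; first by apply: cvgB => //; apply: cvgM => //; apply: cvgM => //; exact: cvg_cst.
  apply: cvgM => //; apply: cvgD => //; apply: cvgM => //; apply: cvgM => //.
  exact: cvgM.
by rewrite -(cvg_lim (@Rhausdorff R) m1_cvg0) (lim_cst (@Rhausdorff R)).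
Qed.

(** The limit of an upper bound for t^-2 times the integral of
    X^2 (X + xi)^2 / qform, where C2 replaces the second moment. *)
Let quartic_ge0 xi : 0 <= C4 + 2 * C2 ^+ 2 + xi ^+ 2 * C2 + 2 * xi * C3.
Proof.
pose rhs k := - ((e k - C2) / t k ^+ 2) + e k * e k * (1 + s k)
  - s k * (p k / t k ^+ 2) * p k
  + ((xi + 2 * p k) * (xi + 2 * p k) - p k ^+ 2) * (u k / t k ^+ 2)
  - p k / t k ^+ 2 * (p k ^+ 2 * (t k * t k) * i k + s k) * (2 * xi + 2 * p k).
have rhs_cvg : rhs @ \oo --> C4 + 2 * C2 ^+ 2 + xi ^+ 2 * C2 + 2 * xi * C3.
  apply: (@cvg_limE _ (- - C4 + C2 * C2 * (1 + 1) - 1 * - C3 * 0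
    + ((xi + 2 * 0) * (xi + 2 * 0) - 0) * C2
    - - C3 * (0 * (0 * 0) * 1 + 1) * (2 * xi + 2 * 0))); first by ring.
  have c2p : (fun k => 2 * p k) @ \oo --> (2 * 0 : R) by apply: cvgM => //; exact: cvg_cst.
  have xp : (fun k => xi + 2 * p k) @ \oo --> (xi + 2 * 0 : R).
    by apply: cvgD => //; exact: cvg_cst.
  have x2p : (fun k => 2 * xi + 2 * p k) @ \oo --> (2 * xi + 2 * 0 : R).
    by apply: cvgD => //; exact: cvg_cst.
  have c1s : (fun k => 1 + s k) @ \oo --> (1 + 1 : R).
    by apply: cvgD => //; exact: cvg_cst.
  apply: cvgB; [apply: cvgD; [apply: cvgB; [apply: cvgD|]|]|].
  - exact: cvgN.
  - by apply: cvgM => //; exact: cvgM.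
  - by apply: cvgM => //; exact: cvgM.
  - by apply: cvgM => //; apply: cvgB => //; exact: cvgM.
  - apply: cvgM => //; apply: cvgM => //; apply: cvgD => //; apply: cvgM => //.
    by apply: cvgM => //; exact: cvgM.
apply: (cvgr_to_ge rhs_cvg); apply: nearW => k.
(* x^2 (x + xi)^2 = (x^2 + a x + b) qform(x) + (c x - r b) *)
pose r := p k ^+ 2 + q k ^+ 2.
pose a := 2 * xi + 2 * p k.
pose b := (xi + 2 * p k) ^+ 2 - r.
pose c := 2 * p k * b - r * a.
have ge0 : 0 <= m2 + b + (c * p k - r * b) * (t k / q k).
  have -> : m2 + b + (c * p k - r * b) * (t k / q k) =
    \int[mu]_(x in S) ((X x * (X x + xi)) ^+ 2 / qform (p k) (q k) (X x)).
    transitivity (\int[mu]_(x in S) ((1 * X x ^+ 2 + a * X x + b * cst 1 x)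
        + (c * X x + - (r * b)) / qform (p k) (q k) (X x))).
      rewrite RintegralD//; last exact: integrable_lin_qform.
        rewrite (resolvent_lin mS mX (pqt k)) RintegralD3//; last exact: finite_measure_integrable_cst.
        by rewrite mean_eq0 /cst (Rintegral_one mS muS) -/m2; ring.
      apply: rintegrableD => //; [apply: rintegrableD => //|]; apply: rintegrableZl => //.
      exact: finite_measure_integrable_cst.
    apply: eq_Rintegral => x _; rewrite /cst.
    have := qform_gt0 (p k) (X x) (q_gt0 k) => /gt_eqF/negbT.
    by rewrite /qform /c /b /a /r => ?; field.
  apply: Rintegral_ge0 => x _.
  by rewrite divr_ge0 ?sqr_ge0// ltW// qform_gt0.
have -> : rhs k = (C2 + b + (c * p k - r * b) * (t k / q k)) / t k ^+ 2.
  rewrite /rhs u_t /c /b /a /r /e /i /s.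
  by field; rewrite !gt_eqF.
apply: divr_ge0; last exact: sqr_ge0.
by apply: (le_trans ge0); rewrite !lerD2r.
Qed.

(** For a law with four moments this is the Cauchy-Schwarz inequality
    (E X^3)^2 <= E X^2 E X^4 of the centred variable, as
    E X^4 = C4 + 2 C2^2. *)
Lemma resolvent_hankel_ge0 : C3 ^+ 2 <= C2 * (C4 + 2 * C2 ^+ 2).
Proof.
have [C20|C2n0] := eqVneq C2 0.
  have [->|C3n0] := eqVneq C3 0; first by rewrite C20 mul0r expr0n.
  (* an affine function of xi that is bounded below is constant *)
  have := quartic_ge0 (- (C4 + 1) / (2 * C3)); rewrite C20.
  rewrite (_ : C4 + _ + _ + _ = - 1); first by rewrite oppr_ge0 ler10.
  by field.
have C2gt0 : 0 < C2 by rewrite lt_neqAle eq_sym C2n0.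
(* the minimum of the quadratic *)
have := quartic_ge0 (- C3 / C2).
rewrite (_ : _ + _ + _ + _ = (C2 * (C4 + 2 * C2 ^+ 2) - C3 ^+ 2) / C2).
  by rewrite pmulr_lge0 ?invr_gt0// subr_ge0.
by field.
Qed.

End ResolventPositivity.
(** * Free convolution powers and inverse Cauchy transforms *)

Section FreePower.
Context {R : realType}.
Implicit Types (mu nu rho : realProbability R) (phi : R[i] -> R[i]).

Lemma subset_Lambda (g d1 d2 : R) : d1 <= d2 -> Lambda g d1 `<=` Lambda g d2.
Proof.
move=> d12 w [w1 w2 w3]; split => //.
by apply: le_lt_trans w2; rewrite lerN2.
Qed.

Lemma voiculescu_transformW mu (g d1 d2 : R) phi : d1 <= d2 ->
  voiculescu_transform mu g d2 phi -> voiculescu_transform mu g d1 phi.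
Proof.
move=> d12 [H [lam [M [lam0 M0 inj HH]]] phiE]; exists H.
  by exists lam, M; split => // w /(subset_Lambda d12); exact: HH.
by move=> z /(subset_Lambda d12); exact: phiE.
Qed.

Lemma eq_cauchy_transform mu nu :
  (forall A : set (measurableTypeR R), measurable A -> mu A = nu A) ->
  cauchy_transform mu = cauchy_transform nu.
Proof.
move=> munu; apply/funext => z; rewrite /cauchy_transform /Rintegral.
by congr (_ +i* _)%C; congr fine; apply: eq_measure_integral => A mA _; exact: munu.
Qed.

(** A transform of [mu] is produced from any transform of [rho]
    on a small enough domain.  In this form the induction never has to compare
    two transforms of one measure that come from different univalence
    cones. *)
Lemma free_power_voiculescu rho (n : nat) mu (g : R) : 0 < g -> free_power rho n mu ->
  exists2 d0 : R, 0 < d0 & forall (d : R) phi, 0 < d <= d0 ->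
    voiculescu_transform rho g d phi ->
    exists2 psi, voiculescu_transform mu g d psi &
      forall z, Lambda g d z^-1 -> psi z = n%:R * phi z.
Proof.
move=> g0; elim=> [nu nurho|{}n nu {}mu _ [d1 d10 IH] [ex add]].
  exists 1 => // d phi _ rphi; exists phi; last by move=> z _; rewrite mul1r.
  case: rphi => H HH phiE; exists H => //.
  by rewrite /cauchy_right_inverse (eq_cauchy_transform nurho).
have [d2 d20 [_ _ [psi mupsi]]] := ex g g0.
exists (Num.min d1 d2); first by rewrite lt_min d10.
move=> d phi; rewrite le_min => /and3P[d_gt0 dd1 dd2] rphi.
have dd : 0 < d <= d1 by rewrite d_gt0.
have [chi nuchi chiE] := IH d phi dd rphi.
have mupsi' := voiculescu_transformW dd2 mupsi.
exists psi => // z zL; rewrite (add g d chi phi psi)// chiE//.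
by rewrite -[in RHS]natr1 mulrDl mul1r.
Qed.

(** For n = 1 the measure [rho] need not come with a transform; from n = 2 on,
    the last free convolution provides one. *)
Lemma free_power_right_inverse rho (n : nat) mu : (1 < n)%N -> free_power rho n mu ->
  exists (d M : R) (H K : R[i] -> R[i]), [/\ 0 < d, 0 < M &
    forall w, Lambda 1 d w ->
    [/\ M < complex.Im (H w) /\ cauchy_transform mu (H w) = w,
        0 < complex.Im (K w) /\ cauchy_transform rho (K w) = w &
        H w - w^-1 = n%:R * (K w - w^-1)]].
Proof.
move=> n1 fp; have [d1 d10 IH] := free_power_voiculescu (@ltr01 R) fp.
have [d2 d20 [phi rphi]] : exists2 d2 : R, 0 < d2 &
    exists phi, voiculescu_transform rho 1 d2 phi.
  case: fp n1 => // {IH}n' nu {}mu _ [ex _] _.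
  by have [d2 d20 [_ phi _]] := ex 1 ltr01; exists d2.
pose d := Num.min d1 d2.
have d0 : 0 < d by rewrite lt_min d10.
have dd1 : 0 < d <= d1 by rewrite d0 ge_min lexx.
have dd2 : d <= d2 by rewrite ge_min lexx orbT.
have rphi' := voiculescu_transformW dd2 rphi.
have [psi mpsi psiE] := IH d phi dd1 rphi'.
case: rphi' => K [lam' [M' [_ M'0 _ HK]]] phiE.
case: mpsi => H [lam [M [_ M0 _ HH]]] psiE'.
exists d, M, H, K; split => // w wL.
have [[_ H1] H2] := HH w wL; have [[_ K1] K2] := HK w wL.
split; [by []|by split => //; exact: lt_trans K1|].
have wL' : Lambda 1 d (w^-1)^-1 by rewrite invrK.
by have := psiE _ wL'; rewrite psiE'// phiE// invrK.
Qed.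

(** Translation by [c] moves the point by [- c] along the real axis. *)
Lemma cauchy_resolvent_point mu (c t : R) (z : R[i]) : 0 < complex.Im z ->
  cauchy_transform mu z = (0 +i* - t)%C ->
  resolvent_point mu setT (fun x => x - c) (complex.Re z - c) (complex.Im z) t.
Proof.
case: z => a b /= b0 [re im].
have D0 (x : R) := qform_gt0 (a - c) (x - c) b0.
have ReE (x : R) : complex.Re ((a +i* b)%C - x%:C%C)^-1 =
    - ((x - c - (a - c)) / qform (a - c) b (x - c)).
  rewrite /= subr0 /qform; have -> : x - c - (a - c) = x - a by ring.
  by rewrite -mulNr opprB -[(x - a) ^+ 2]sqrrN opprB.
have ImE (x : R) : complex.Im ((a +i* b)%C - x%:C%C)^-1 =
    - b * (qform (a - c) b (x - c))^-1.
  rewrite /= subr0 /qform; have -> : x - c - (a - c) = x - a by ring.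
  by rewrite mulNr -[(x - a) ^+ 2]sqrrN opprB.
have mX : measurable_fun setT (fun x : measurableTypeR R => x - c).
  exact: measurable_funB.
split => //.
- apply: oppr_inj; rewrite oppr0 -[RHS]re -[LHS]mulN1r -RintegralZl//.
    by apply: eq_Rintegral => x _; rewrite mulN1r; exact: esym (ReE x).
  exact: integrable_sub_qform.
- apply: (mulfI (_ : - b != 0)); first by rewrite oppr_eq0 gt_eqF.
  rewrite -RintegralZl//; last exact: integrable_inv_qform.
  transitivity (- t); last by field; rewrite gt_eqF.
  by rewrite -im; apply: eq_Rintegral => x _; exact: esym (ImE x).
Qed.

End FreePower.
(** * The bound on cumulants and the example *)

Lemma resolvent_point_full_measure d (T : measurableType d) (R : realType)
    (mu : probability T R) (S : set T) (X : T -> R) (p q t : R) :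
  measurable S -> mu S = 1%E -> measurable_fun setT X ->
  resolvent_point mu setT X p q t -> resolvent_point mu S X p q t.
Proof.
move=> mS muS mX [q0 H0 H1].
have full f : mu.-integrable setT (EFin \o f) ->
    \int[mu]_x f x = \int[mu]_(x in S) f x.
  move=> fi; rewrite /Rintegral (@negligible_integral _ _ _ mu _ (~` S))//.
  - by rewrite setDE setCK setTI.
  - exact: measurableC.
  - by rewrite [LHS]probability_setC// [X in (_ - X)%E]muS subee.
split => //.
- by rewrite -full//; exact: integrable_sub_qform.
- by rewrite -full//; exact: integrable_inv_qform.
Qed.

Lemma resolvent_asymptotics_div (R : realType) (n : R) (p q p' q' t : nat -> R)
    (C2 C3 C4 : R) : 0 < n -> (forall k, 0 < t k) ->
  (forall k, p' k = p k / n) ->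
  (forall k, q k - (t k)^-1 = n * (q' k - (t k)^-1)) ->
  resolvent_asymptotics p q t C2 C3 C4 ->
  resolvent_asymptotics p' q' t (C2 / n) (C3 / n) (C4 / n).
Proof.
move=> n0 t0 pE qE [pt et et2].
have eE k : (1 - q' k * t k) / t k ^+ 2 = (1 - q k * t k) / t k ^+ 2 / n.
  rewrite (_ : q k = n * (q' k - (t k)^-1) + (t k)^-1); last by rewrite -qE subrK.
  by field; rewrite !gt_eqF.
have cn : (fun=> n^-1) @ \oo --> n^-1 by exact: cvg_cst.
split.
- rewrite (_ : (fun k => _) = (fun k => p k / t k ^+ 2 / n)).
    by rewrite -mulNr; exact: cvgM.
  by apply/funext => k; rewrite pE mulrAC.
- by rewrite (funext eE); exact: cvgM.
- rewrite (_ : (fun k => _) =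
      (fun k => ((1 - q k * t k) / t k ^+ 2 - C2) / t k ^+ 2 / n)).
    by rewrite -mulNr; exact: cvgM.
  by apply/funext => k; rewrite eE -mulrBl mulrAC.
Qed.

(** The numbers v2, v3 and v4 - 2 v2^2 are the free cumulants of [mu].  Centring
    [rho] at m / n instead of m makes the real parts of the two inverse Cauchy
    transforms proportional. *)
Lemma free_power_cumulant_bound (R : realType) (mu rho : realProbability R)
    (n : nat) (S : set R) (m B : R) :
  (1 < n)%N -> free_power rho n mu ->
  measurable (S : set (measurableTypeR R)) -> mu S = 1%E ->
  (forall x, S x -> `|x - m| <= B) ->
  let v k := \int[mu]_(x in S) ((x - m) ^+ k) in
  v 1%N = 0 ->
  v 3%N ^+ 2 <= v 2%N * (v 4%N - 2 * v 2%N ^+ 2 + 2 * v 2%N ^+ 2 / n%:R).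
Proof.
move=> n1 fp mS muS SB v v1.
have [d [M [H [K [d0 M0 HK]]]]] := free_power_right_inverse n1 fp.
have n0 : 0 < n%:R :> R by rewrite ltr0n ltnW.
(* starts at d / 2, as Lambda 1 d contains - i t only for t < d *)
pose t k : R := d * harmonic k.+1.
have t0 k : 0 < t k by rewrite mulr_gt0// harmonic_gt0.
have t_cvg0 : t @ \oo --> 0.
  apply: (@cvg_limE _ (d * 0)); first by rewrite mulr0.
  by apply: cvgM; [exact: cvg_cst|rewrite (cvg_shiftS (@harmonic R)); exact: cvg_harmonic].
pose w k : R[i] := (0 +i* - t k)%C.
have wL k : Lambda 1 d (w k).
  split; rewrite /= ?normr0 ?mulr0 ?opprK//.
  - rewrite ltrN2 /t gtr_pMr// /harmonic invf_lt1 ?ltr1n//.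
  - by rewrite oppr_lt0.
have wV k : (w k)^-1 = (0 +i* (t k)^-1)%C.
  rewrite /w; apply/eqP; rewrite eq_complex /=; apply/andP; split; apply/eqP.
    by rewrite mul0r.
  by field; rewrite gt_eqF.
pose p k := complex.Re (H (w k)) - m.
pose q k := complex.Im (H (w k)).
pose p' k := complex.Re (K (w k)) - m / n%:R.
pose q' k := complex.Im (K (w k)).
have ReIm k : complex.Re (H (w k)) = n%:R * complex.Re (K (w k)) /\
    q k - (t k)^-1 = n%:R * (q' k - (t k)^-1).
  have [_ _] := HK _ (wL k); rewrite wV -(rmorph_nat (real_complex R)) /q /q'.
  by case: (H (w k)) => a b; case: (K (w k)) => a' b' [];
    rewrite /= !subr0 !mul0r ?addr0 ?subr0 => -> ->.
have mX c : measurable_fun setT (fun x : measurableTypeR R => x - c).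
  exact: measurable_funB.
have muP k : resolvent_point mu S (fun x => x - m) (p k) (q k) (t k).
  have [[qM HE] _ _] := HK _ (wL k); apply: resolvent_point_full_measure => //.
  by apply: cauchy_resolvent_point => //; exact: lt_trans qM.
have rhoP k : resolvent_point rho setT (fun x => x - m / n%:R) (p' k) (q' k) (t k).
  by have [_ [q0 KE] _] := HK _ (wL k); apply: cauchy_resolvent_point.
have qM k : M < q k by have [[]] := HK _ (wL k).
have mXS : measurable_fun S (fun x : measurableTypeR R => x - m).
  exact: measurable_funS (mX m).
have := bounded_resolvent_asymptotics mS muS mXS SB v1 t0 t_cvg0 muP M0 qM.
have pE k : p' k = p k / n%:R.
  by rewrite /p' /p (ReIm k).1; field; rewrite gt_eqF.
move=> /(resolvent_asymptotics_div n0 t0 pE (fun k => (ReIm k).2)) asym.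
have := resolvent_hankel_ge0 (@measurableT _ _) (@probability_setT _ _ _ rho)
  (mX _) t0 t_cvg0 rhoP asym.
rewrite -!/(v _).
rewrite (_ : (v 3%N / n%:R) ^+ 2 = v 3%N ^+ 2 / n%:R ^+ 2); last by rewrite expr_div_n.
rewrite ler_pdivrMr ?exprn_gt0// => /le_trans; apply.
by rewrite le_eqVlt; apply/orP; left; apply/eqP; field; rewrite gt_eqF.
Qed.

Theorem theorem5p4 (R : realType) :
  exists a1 a2 : R, [/\ 0 < a1, 0 < a2, a1 + 2 * a2 = 1 &
    exists2 mu : realProbability R,
      (forall A : set (measurableTypeR R), measurable A -> mu A = eta_measure a1 a2 A) &
      ~ freely_infinitely_divisible mu].
Proof.
have a1_gt0 : 0 < 4 / 5 :> R by [].
have a2_gt0 : 0 < 1 / 10 :> R by [].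
have a12 : 4 / 5 + 2 * (1 / 10) = 1 :> R by field.
exists (4 / 5), (1 / 10); split => //.
have [mu muE] := eta_measure_probability (ltW a1_gt0) (ltW a2_gt0) a12.
exists mu => // /(_ 200%N isT)[rho rhoP].
have muS := eta_supp a12 muE.
pose S : set R := `](Num.sqrt 2 - 1) ^+ 2, (Num.sqrt 2 + 1) ^+ 2[%classic.
pose mom j := \int[mu]_(x in S) (x ^+ j).
have momE j : mom j = (4 / 5 * sqrt_moment j.+2 + 1 / 10 * sqrt_moment j) / (2 * pi).
  exact: eta_moment.
have S06 x : S x -> 0 < x < 6.
  rewrite /S /= in_itv/= => /andP[/(lt_trans (@lo_gt0 R)) -> /lt_trans]; apply.
  exact: hi_lt6.
have mS : measurable (S : set (measurableTypeR R)) by exact: measurable_itv.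
have mom_int j : mu.-integrable S (EFin \o (fun x : R => x ^+ j)).
  apply: (integrable_bounded mu mS (M := 6 ^+ j)); first exact: exprn_measurable.
  move=> x /S06/andP[x0 x6]; rewrite normrX gtr0_norm//.
  by apply: lerXn2r; rewrite ?nnegrE// ltW.
have [m1 m2 m3 m4] : [/\ mom 1%N = 17 / 10, mom 2%N = 49 / 10,
    mom 3%N = 89 / 5 & mom 4%N = 363 / 5].
  have pi0 : (pi : R) != 0 by rewrite gt_eqF// pi_gt0.
  rewrite !momE; have [_ -> -> -> ->] := @sqrt_momentE R; rewrite sqrt_moment2 sqrt_moment3.
  by move: pi0; move: (pi : R) => x x0; split; field; rewrite ?x0.
have S6 x : S x -> `|x - 17 / 10| <= 6.
  by move=> /S06/andP[x0 x6]; rewrite ler_norml; apply/andP; split; lra.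
have [] := shifted_moments mS muS (17 / 10) mom_int.
rewrite -/(mom 1%N) -/(mom 2%N) -/(mom 3%N) -/(mom 4%N) m1 m2 m3 m4 => v1 v2 v3 v4.
have vE := free_power_cumulant_bound (n := 200) isT rhoP mS muS S6.
move: vE => /=; rewrite v1 v2 v3 v4 => /(_ (subrr _)).
lra.
Qed.
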